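(* Let $\mu=\frac1l\sum_{i=1}^l\delta_{x_i}$ and $\nu=\frac1m\sum_{j=1}^m\delta_{y_j}$ be empirical measures on $\mathbb{R}$ in convex order, with $l,m\geqslant 2$, let $\mathbf K_I$ be the information-based martingale optimal transport objective on $\mathcal M(\mu,\nu)$ associated with a standard randomised arcade process, and let $\pi_I^*$ be its maximiser over $\mathcal M(\mu,\nu)$ (all defined in the context). Let $\epsilon>0$, $$\delta=\max_{\pi_1,\pi_2\in\mathcal M(\mu,\nu)}\|\pi_1-\pi_2\|,\qquad \Theta=4\left\lceil\frac{\delta^2\|\nabla\mathbf K_I\|_\infty^2}{\epsilon^2}\right\rceil,\qquad \lambda=\frac{\epsilon}{2\|\nabla\mathbf K_I\|_\infty^2}.$$ Let $\pi^{(0)}\in\mathcal M(\mu,\nu)$ be arbitrary and, for $\theta=1,\ldots,\Theta$, let $$\hat\pi^{(\theta)}=\pi^{(\theta-1)}+\lambda\nabla\mathbf K_I(\pi^{(\theta-1)}),\qquad \pi^{(\theta)}=\operatorname{Proj}_{\mathcal M(\mu,\nu)}(\hat\pi^{(\theta)}),$$ where $\operatorname{Proj}_{\mathcal M(\mu,\nu)}$ is the Euclidean projection onto $\mathcal M(\mu,\nu)$. Then $$\mathbf K_I(\pi_I^* )-\mathbf K_I\left(\frac1\Theta\sum_{\theta=1}^\Theta\pi^{(\theta-1)}\right)\leqslant\epsilon.$$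
   Context: Fix $0\leqslant T_0<T_1<\infty$. $\mathcal M(\mu,\nu)$ is the set of martingale couplings: probability measures $\pi$ on $\mathbb{R}^2$ with marginals $\mu,\nu$ such that $(X_0,X_1)\sim\pi$ implies $\mathbb{E}[X_1\mid X_0]=X_0$; it is nonempty because $\mu\leqslant_{\mathrm{cx}}\nu$, i.e. $\int f\,\mathrm d\mu\leqslant\int f\,\mathrm d\nu$ for all convex $f$. The $x_i$ are distinct and the $y_j$ are distinct. A coupling $\pi$ is identified with the vector in $\mathbb{R}^{lm}$ of its entries $p_{ij}=\pi(\{x_i\},\{y_j\})$; $\|\cdot\|$ and $\langle\cdot,\cdot\rangle$ are the Euclidean norm and inner product on $\mathbb{R}^{lm}$. Randomised arcade process: let $(D_t)_{t\in[T_0,T_1]}$ be a sample-continuous Gauss-Markov process (driver), independent of $(X_0,X_1)$, with $\mathbb P[D_t=0]<1$ for $t\in(T_0,T_1)$ and covariance $K_D(x,y)=H_1(\min(x,y))H_2(\max(x,y))$, $H_1,H_2$ differentiable almost everywhere. Interpolating coefficients are continuous functions $f_0,f_1$ on $[T_0,T_1]$ with $f_i(T_i)=1$, $f_i(T_j)=0$ for $i\ne j$. Put $A_t^{(1)}=D_t-f_0(t)D_{T_0}-f_1(t)D_{T_1}$ and $I_t^{(1)}=g_0(t)X_0+g_1(t)X_1+A_t^{(1)}$, with $f_0,f_1$ and $g_0,g_1$ interpolating coefficients, where the RAP is standard: $f_0(t)=\frac{H_1(T_1)H_2(t)-H_1(t)H_2(T_1)}{H_1(T_1)H_2(T_0)-H_1(T_0)H_2(T_1)}$,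 $f_1(t)=\frac{H_1(t)H_2(T_0)-H_1(T_0)H_2(t)}{H_1(T_1)H_2(T_0)-H_1(T_0)H_2(T_1)}$, $g_1=f_1$. It is assumed that $(I^{(1)}_t)$ is a semimartingale and that, for each $\pi\in\mathcal M(\mu,\nu)$, $(t,z)\mapsto M_t(z,x_i)$ (formula below) is $C^2$ on $((T_0,T_1)\setminus N)\times\mathrm{Im}(I^{(1)})$ for a finite set $N$. For $t\in(T_0,T_1)$, $f^{A_t^{(1)}}$ denotes the Gaussian density of $A_t^{(1)}$. Objective: for $\pi\in\mathcal M(\mu,\nu)$ and $(X_0,X_1)\sim\pi$, let $M_t=\mathbb{E}_\pi[X_1\mid X_0,I_t^{(1)}]$ and $$\mathbf K_I(\pi)=\mathbb{E}\left[\int_{T_0}^{T_1}\frac{(X_1-M_t)^2\sqrt{H_1'(t)H_2(t)-H_1(t)H_2'(t)}}{H_1(T_1)H_2(t)-H_1(t)H_2(T_1)}\,\mathrm dt\right].$$ The maximiser of $\mathbf K_I$ over $\mathcal M(\mu,\nu)$ exists and is unique, and is denoted $\pi_I^*$. As a function of the entries $p_{ij}$, $$\mathbf K_I=\int_{T_0}^{T_1}\frac{\sqrt{H_1'(t)H_2(t)-H_1(t)H_2'(t)}}{H_1(T_1)H_2(t)-H_1(t)H_2(T_1)}\sum_{i=1}^l\sum_{j=1}^m p_{ij}\int_{-\infty}^\infty\bigl(y_j-M_t(g_0(t)x_i+g_1(t)y_j+a,x_i)\bigr)^2f^{A_t^{(1)}}(a)\,\mathrm da\,\mathrm dt,$$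 where $M_t(z,x_i)=\frac{\sum_{j}y_jf^{A_t^{(1)}}(z-g_0(t)x_i-g_1(t)y_j)p_{ij}}{\sum_{j}f^{A_t^{(1)}}(z-g_0(t)x_i-g_1(t)y_j)p_{ij}}$. $\nabla\mathbf K_I$ is the gradient of this function with respect to the $lm$ entries $p_{ij}$, treated as independent variables, and $\|\nabla\mathbf K_I\|_\infty=\sup_{\pi\in\mathcal M(\mu,\nu)}\|\nabla\mathbf K_I(\pi)\|$. As presupposed by the definitions of $\lambda$ and $\Theta$ and by the final average, it is assumed that $\nabla\mathbf K_I$ exists on $\mathcal M(\mu,\nu)$, that $0<\|\nabla\mathbf K_I\|_\infty<\infty$, and that $\Theta\geqslant1$. *)

(* Defs.v *)
From HB Require Import structures.
From mathcomp Require Import all_boot all_order all_algebra.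
From mathcomp Require Import all_classical all_reals all_analysis.

Set Implicit Arguments.
Unset Strict Implicit.
Unset Printing Implicit Defensive.

Import Order.TTheory GRing.Theory Num.Theory.
Import numFieldNormedType.Exports.

Local Open Scope classical_set_scope.
Local Open Scope ring_scope.

Section empirical_measure.
Local Open Scope ereal_scope.
Context {R : realType} (n : nat) (x : 'I_n -> R).

Definition empirical (A : set R) : \bar R :=
  (n%:R^-1)%:E * \sum_(i < n) \d_(x i) A.

Let scale_ge0 : (0 <= n%:R^-1 :> R)%R. Proof. by rewrite invr_ge0. Qed.

Let dirac_ord (k : nat) : {measure set R -> \bar R} :=
  if insub k is Some i then \d_(x i) else mzero.

Let empiricalE : empirical = mscale (NngNum scale_ge0) (msum dirac_ord n).
Proof.
apply/funext => A; rewrite /empirical /mscale/= /msum; congr (_ * _).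
by apply: eq_bigr => i _; rewrite /dirac_ord valK.
Qed.

Let empirical0 : empirical set0 = 0.
Proof. by rewrite empiricalE measure0. Qed.

Let empirical_ge0 A : 0 <= empirical A.
Proof. by rewrite empiricalE measure_ge0. Qed.

Let empirical_sigma_additive : semi_sigma_additive empirical.
Proof. rewrite empiricalE; exact: measure_semi_sigma_additive. Qed.

HB.instance Definition _ := isMeasure.Build _ _ _ empirical
  empirical0 empirical_ge0 empirical_sigma_additive.

End empirical_measure.

Definition convex_order {R : realType} (mu nu : {measure set R -> \bar R}) :=
  forall f : R -> R, convex_function (setT : set R) f ->
    (\int[mu]_z (f z)%:E <= \int[nu]_z (f z)%:E)%E.

Section conditional_expectation.
Context {R : realType} {d : measure_display} {T : measurableType d}.

Definition sigma_of {d' : measure_display} {T' : measurableType d'}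
    (f : T -> T') : set (set T) :=
  preimage_set_system setT f measurable.

Definition measurable_wrt (G : set (set T)) (f : T -> R) :=
  forall B : set R, measurable B -> G (f @^-1` B).

Variable mu : {measure set T -> \bar R}.

(* Y is a version of E[X | G] *)
Definition is_cond_exp (G : set (set T)) (X Y : T -> R) :=
  [/\ mu.-integrable setT (EFin \o X), mu.-integrable setT (EFin \o Y),
      measurable_wrt G Y &
      forall A, G A -> \int[mu]_(w in A) (Y w)%:E = \int[mu]_(w in A) (X w)%:E]%E.

End conditional_expectation.

Section semimartingale.
Context {R : realType} {d : measure_display} {T : measurableType d}.
Variables (mu : {measure set T -> \bar R}) (a b : R).
Implicit Types (F : R -> set (set T)) (X : R -> T -> R).

Definition filtration F :=
  (forall t, t \in `[a, b] -> sigma_algebra setT (F t) /\ F t `<=` measurable) /\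
  (forall s t, s \in `[a, b] -> t \in `[a, b] -> s <= t -> F s `<=` F t).

Definition adapted F X :=
  forall t, t \in `[a, b] -> measurable_wrt (F t) (X t).

Definition is_martingale F X :=
  adapted F X /\
  forall s t, s \in `[a, b] -> t \in `[a, b] -> s <= t ->
    is_cond_exp mu (F s) (X t) (X s).

Definition stopping_time F (tau : T -> R) :=
  (forall w, tau w \in `[a, b]) /\
  (forall t, t \in `[a, b] -> F t [set w | tau w <= t]).

Definition cadlag (f : R -> R) :=
  (forall t, t \in `[a, b[ -> f @ t^'+ --> f t) /\
  (forall t, t \in `]a, b] -> cvg (f @ t^'-)).

(* On the compact interval [a, b] a localising sequence is a nondecreasing
   sequence of stopping times almost surely eventually equal to b. *)
Definition local_martingale F X :=
  [/\ adapted F X, {ae mu, forall w, cadlag (X ^~ w)} &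
    exists tau : nat -> T -> R,
    [/\ forall n, stopping_time F (tau n),
        forall n w, tau n w <= tau n.+1 w,
        {ae mu, forall w, exists N, forall n, (N <= n)%N -> tau n w = b} &
        forall n, is_martingale F
          (fun t w => X (Num.min t (tau n w)) w - X a w)]].

(* The filtration is existentially quantified; by Stricker's theorem a
   semimartingale for some filtration is one for its natural filtration. *)
Definition semimartingale X :=
  exists F N V,
  [/\ filtration F /\ adapted F X,
      local_martingale F N,
      adapted F V,
      {ae mu, forall w, cadlag (V ^~ w) /\ bounded_variation a b (V ^~ w)} &
      {ae mu, forall w, forall t, t \in `[a, b] -> X t w = N t w + V t w}].

End semimartingale.

Section smoothness.
Context {R : realType}.
Implicit Types (U : set (R * R)) (F : R * R -> R).

Let e1 : R * R := (1, 0).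
Let e2 : R * R := (0, 1).

Definition C0_open U F := forall z, U z -> {for z, continuous F}.

Definition C1_open U F :=
  [/\ C0_open U F, forall z, U z -> derivable F z e1 /\ derivable F z e2,
      C0_open U ('D_e1 F) & C0_open U ('D_e2 F)].

Definition C2_open U F :=
  [/\ C1_open U F, C1_open U ('D_e1 F) & C1_open U ('D_e2 F)].

(* C^2 on an arbitrary set: restriction of a C^2 function on an open superset *)
Definition C2_on (S : set (R * R)) F :=
  exists U G, [/\ open U, S `<=` U, C2_open U G & forall z, S z -> F z = G z].

End smoothness.

Section driver.
Context {R : realType} {d : measure_display} {Omega : measurableType d}.
Variables (P : probability Omega R) (T0 T1 : R).

(* s = 0 is the degenerate law \d_m *)
Definition gaussian_variable (X : Omega -> R) :=
  exists m s : R, forall B : set R, measurable B ->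
    P (X @^-1` B) = if s == 0 then \d_m B else normal_prob m s B.

Definition gaussian_process (D : R -> {RV P >-> R}) :=
  forall n (t c : 'I_n -> R), (forall k, t k \in `[T0, T1]) ->
    gaussian_variable (fun w => \sum_(k < n) c k * D (t k) w).

Definition past (D : R -> {RV P >-> R}) (s : R) : set (set Omega) :=
  <<s \bigcup_(u in `[T0, s]) sigma_of (D u) >>.

(* P[D_t in B | D_u, u <= s] = P[D_t in B | D_s] *)
Definition markov_process (D : R -> {RV P >-> R}) :=
  forall s t, s \in `[T0, T1] -> t \in `[T0, T1] -> s <= t ->
  forall B : set R, measurable B ->
  exists Y : Omega -> R,
    is_cond_exp P (sigma_of (D s)) (\1_(D t @^-1` B)) Y /\
    is_cond_exp P (past D s) (\1_(D t @^-1` B)) Y.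

Record driver (H1 H2 : R -> R) (D : R -> {RV P >-> R}) : Prop := {
  driver_continuous :
    {ae P, forall w, {within `[T0, T1], continuous (fun t => D t w)}};
  driver_gaussian : gaussian_process D;
  driver_markov : markov_process D;
  driver_neq0 : forall t, t \in `]T0, T1[ -> (P (D t @^-1` [set 0%R]) < 1)%E;
  driver_covariance : forall s t, s \in `[T0, T1] -> t \in `[T0, T1] ->
    covariance P (D s) (D t) = (H1 (Num.min s t) * H2 (Num.max s t))%:E;
  driver_H1 : {ae lebesgue_measure, forall t : R, t \in `[T0, T1] ->
    derivable H1 t 1};
  driver_H2 : {ae lebesgue_measure, forall t : R, t \in `[T0, T1] ->
    derivable H2 t 1}
}.

Definition interpolating (f0 f1 : R -> R) :=
  [/\ {within `[T0, T1], continuous f0}, {within `[T0, T1], continuous f1},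
      f0 T0 = 1 /\ f0 T1 = 0 & f1 T0 = 0 /\ f1 T1 = 1].

End driver.

Section standard_rap.
Context {R : realType} {d : measure_display} {Omega : measurableType d}.
Variables (P : probability Omega R) (T0 T1 : R) (H1 H2 : R -> R).
Variables (D : R -> {RV P >-> R}) (g0 : R -> R).

Definition std_f0 (t : R) : R :=
  (H1 T1 * H2 t - H1 t * H2 T1) / (H1 T1 * H2 T0 - H1 T0 * H2 T1).

Definition std_f1 (t : R) : R :=
  (H1 t * H2 T0 - H1 T0 * H2 t) / (H1 T1 * H2 T0 - H1 T0 * H2 T1).

Definition arcade (t : R) (w : Omega) : R :=
  D t w - std_f0 t * D T0 w - std_f1 t * D T1 w.

(* Sample points are triples (w, (X_0, X_1)) in Omega * (R * R); under the
   product measure P \x pi the driver is independent of (X_0, X_1) ~ pi. *)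
Definition X0 (w : Omega * (R * R)) : R := w.2.1.
Definition X1 (w : Omega * (R * R)) : R := w.2.2.

Definition rap (t : R) (w : Omega * (R * R)) : R :=
  g0 t * X0 w + std_f1 t * X1 w + arcade t w.1.

Definition arcade_density (t : R) : R -> R :=
  normal_pdf (fine 'E_P[arcade t]) (Num.sqrt (fine 'V_P[arcade t])).

(* The positive variance is what makes the Gaussian density of A_t exist. *)
Record standard_rap : Prop := {
  rap_driver : driver T0 T1 H1 H2 D;
  rap_f : interpolating T0 T1 std_f0 std_f1;
  rap_g : interpolating T0 T1 g0 std_f1;
  rap_nondegenerate : forall t, t \in `]T0, T1[ -> (0 < 'V_P[arcade t])%E
}.

Definition weight (t : R) : R :=
  Num.sqrt (derive1 H1 t * H2 t - H1 t * derive1 H2 t) /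
  (H1 T1 * H2 t - H1 t * H2 T1).

Local Notation prod_measure pi := (P \x pi)%E.

(* A jointly measurable version of M_t = E_pi[X_1 | X_0, I_t], T0 < t < T1;
   the objective below does not depend on the version. *)
Definition is_info_mean (pi : probability (R * R)%type R)
    (M : R -> Omega * (R * R) -> R) :=
  measurable_fun (`]T0, T1[ `*` setT)
    (fun tw : R * (Omega * (R * R)) => M tw.1 tw.2) /\
  forall t, t \in `]T0, T1[ ->
    is_cond_exp (prod_measure pi) (sigma_of (fun w => (X0 w, rap t w))) X1 (M t).

Definition objective (pi : probability (R * R)%type R)
    (M : R -> Omega * (R * R) -> R) : \bar R :=
  (\int[prod_measure pi]_w \int[lebesgue_measure]_(t in `]T0, T1[)
     ((X1 w - M t w) ^+ 2 * weight t)%:E)%E.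

Context {l m : nat}.
Variables (x : 'I_l -> R) (y : 'I_m -> R).

Definition info_mean (p : 'M[R]_(l, m)) (t z : R) (i : 'I_l) : R :=
  (\sum_(j < m) y j * arcade_density t (z - g0 t * x i - std_f1 t * y j) * p i j) /
  (\sum_(j < m) arcade_density t (z - g0 t * x i - std_f1 t * y j) * p i j).

Definition objective_entries (p : 'M[R]_(l, m)) : \bar R :=
  (\int[lebesgue_measure]_(t in `]T0, T1[)
    ((weight t)%:E * \sum_(i < l) \sum_(j < m) (p i j)%:E *
      \int[lebesgue_measure]_a
        ((y j - info_mean p t (g0 t * x i + std_f1 t * y j + a) i) ^+ 2 *
          arcade_density t a)%:E))%E.

Definition entries (pi : probability (R * R)%type R) : 'M[R]_(l, m) :=
  \matrix_(i, j) fine (pi ([set x i] `*` [set y j])).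

(* values of the process on the support of the law of (X_0, X_1) *)
Definition rap_image (pi : probability (R * R)%type R) : set R :=
  [set z | exists t w i j, [/\ t \in `[T0, T1], 0 < entries pi i j &
     z = rap t (w, (x i, y j))]].

Definition rap_regular (pi : probability (R * R)%type R) :=
  semimartingale (prod_measure pi) T0 T1 rap /\
  exists N : set R, finite_set N /\ forall i,
    C2_on ((`]T0, T1[ `\` N) `*` rap_image pi)
      (fun tz => info_mean (entries pi) tz.1 tz.2 i).

End standard_rap.

Definition martingale_coupling {R : realType} (mu nu : set R -> \bar R)
    (pi : probability (R * R)%type R) :=
  [/\ forall A, measurable A -> pi (A `*` setT) = mu A,
      forall B, measurable B -> pi (setT `*` B) = nu B &
      is_cond_exp pi (sigma_of (fst : R * R -> R)) snd fst].

(* M(mu, nu) for the two empirical measures, as a set of vectors in R^{lm} *)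
Definition coupling_entries {R : realType} {l m : nat}
    (x : 'I_l -> R) (y : 'I_m -> R) : set 'M[R]_(l, m) :=
  [set entries x y pi | pi in martingale_coupling (empirical x) (empirical y)].

Section euclidean.
Context {R : realType} {l m : nat}.
Implicit Types (p q : 'M[R]_(l, m)) (S : set 'M[R]_(l, m)).

(* not the library norm of matrices, which is the maximum norm *)
Definition enorm p : R := Num.sqrt (\sum_i \sum_j p i j ^+ 2).

Definition is_proj S q p :=
  S p /\ forall p', S p' -> enorm (q - p) <= enorm (q - p').

Definition is_max_dist S (r : R) :=
  (exists p q, [/\ S p, S q & r = enorm (p - q)]) /\
  (forall p q, S p -> S q -> enorm (p - q) <= r).

(* G is the vector of the partial derivatives of F at p in the lm entries,
   for F considered on the orthant of nonnegative entries: the derivative in an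
   entry which vanishes at p is one-sided. Convergence of the extended-real
   quotients to the real number G i j forces F to be finite at p and at the
   nearby points p + h *: delta_mx i j. *)
Definition is_gradient (F : 'M[R]_(l, m) -> \bar R) p (G : 'M[R]_(l, m)) :=
  forall (i : 'I_l) (j : 'I_m),
    ((h^-1)%:E * (F (p + h *: delta_mx i j)%R - F p))%E
      @[h --> within [set h : R | 0 <= p i j + h] 0^'] --> (G i j)%:E.

End euclidean.

(* Main.v *)
Require Import Defs.
From HB Require Import structures.
From mathcomp Require Import all_boot all_order all_algebra.
From mathcomp Require Import all_classical all_reals all_analysis.
From mathcomp Require Import measurable_realfun ring lra.

(* For fixed time, the objective is the integral over [z] of the sum over [i] of
   the variance of [y_j] under the weights [p_ij f(z - g_0 x_i - g_1 y_j)], so it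
   is an infimum of linear functions of [p]: replacing the posterior mean of [q]
   by that of [p] gives K(q) <= sum q_ij g_ij(p), with equality at [q = p], where
   g_ij(p) is the integral of f (y_j - M(p))^2.  Coordinatewise one-sided partial
   derivatives of a concave function do not in general give a supergradient at a
   boundary point, but here the increment of the variance when mass [h] is added
   to [p_ij] is explicit, and monotone convergence identifies the gradient with
   [g].  Thus K(q) - K(p) <= <grad K(p), q - p>, and the telescoping argument of
   projected gradient ascent together with Jensen's inequality concludes.  The
   posterior mean agrees almost surely with any version of the conditional
   expectation, so the objective equals its expression in the entries. *)

Set Implicit Arguments.
Unset Strict Implicit.
Unset Printing Implicit Defensive.

Import Order.TTheory GRing.Theory Num.Theory.
Import numFieldNormedType.Exports.

Local Open Scope classical_set_scope.
Local Open Scope ring_scope.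

(** * Measure-theoretic preliminaries *)

(** The derivatives in [is_gradient] are taken along single entries, and [p + h *: delta_mx i j] is
    no longer a coupling, since its row sums change. The functional is therefore studied on the
    larger set of nonnegative matrices without zero row ([proper_weights]). There it is positively
    homogeneous of degree one, so K(p) = <grad K(p), p> and the tangent majorant is linear, not just
    affine. Only positive increments are used, so vanishing entries need no separate treatment. The
    objective lives in the extended reals, and finiteness comes only from the convergence of its
    difference quotients to a real number. Its integrands are nonnegative, so Tonelli and monotone
    convergence apply without an integrable bound. An almost everywhere equal version replaces the
    first, and a translation of the space variable removes the second. The remaining regularity
    comes from the positive variance of the arcade process, whose closed form fixes all the
    signs. *)

Section measure_lemmas.
Local Open Scope ereal_scope.
Context {d : measure_display} {T : measurableType d} {R : realType}.
Variable mu : {measure set T -> \bar R}.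

(** The integral of a nonnegative function is a supremum over the simple functions below it, so
    monotonicity survives without measurability. *)
Lemma ge0_le_integral_nomeas (f g : T -> \bar R) :
  (forall x, 0 <= f x) -> (forall x, f x <= g x) ->
  \int[mu]_x f x <= \int[mu]_x g x.
Proof.
move=> f0 fg; have g0 x : 0 <= g x by exact: le_trans (f0 x) (fg x).
rewrite !ge0_integralTE//; apply: le_ereal_sup => _ [h /= hf <-].
by exists h => // x; exact: le_trans (hf x) (fg x).
Qed.

(** Only [g] is measurable. On [D], [f] is caught between [g] set to 0 and [g] set to [+oo] on the
    exceptional null set, and both bounds have the integral of [g]. This serves for integrands
    containing [weight]. *)
Lemma ge0_ae_eq_integral_nomeas (D : set T) (f g : T -> \bar R) :
  measurable D -> measurable_fun D g ->
  (forall x, D x -> 0 <= f x) -> (forall x, D x -> 0 <= g x) ->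
  ae_eq mu D f g -> \int[mu]_(x in D) f x = \int[mu]_(x in D) g x.
Proof.
move=> mD mg f0 g0 [N [mN N0 subN]].
have fg x : D x -> ~ N x -> f x = g x.
  move=> Dx Nx; apply: contrapT => fgx; apply: Nx; apply: subN => /= H.
  by apply: fgx; exact: H.
rewrite integral_mkcond [RHS]integral_mkcond.
have mgD : measurable_fun setT (g \_ D).
  by apply/(measurable_restrictT g mD).
have f0' x : 0 <= (f \_ D) x.
  by rewrite patchE; case: ifPn => // /set_mem /f0.
have g0' x : 0 <= (g \_ D) x.
  by rewrite patchE; case: ifPn => // /set_mem /g0.
have fg' x : ~ N x -> (f \_ D) x = (g \_ D) x.
  by rewrite !patchE; case: ifPn => // /set_mem; exact: fg.
have mlo : measurable_fun setT ((g \_ D) \_ (~` N)).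
  by apply/(measurable_restrictT (g \_ D) (measurableC mN)); exact: measurable_funTS.
have mhi : measurable_fun setT (fun x => if x \in N then +oo else (g \_ D) x).
  apply: measurable_fun_ifT => //; apply: (measurable_fun_bool true).
  by rewrite setTI (_ : _ @^-1` _ = N)//; apply/seteqP; split => x /=;
    rewrite -[_ = true]/(is_true _) inE.
apply/eqP; rewrite eq_le; apply/andP; split.
- apply: (@le_trans _ _ (\int[mu]_x (if x \in N then +oo else (g \_ D) x))).
    apply: ge0_le_integral_nomeas => // x; case: ifPn => [_|/negP xN].
      by rewrite leey.
    by rewrite fg'// => Nx; apply: xN; rewrite inE.
  rewrite (@ge0_ae_eq_integral _ _ _ mu setT _ (g \_ D))//.
    by move=> x _; case: ifPn.
  exists N; split => // x /= H; apply: contrapT => Nx; apply: H => _.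
  by rewrite ifN//; apply/negP; rewrite inE.
- apply: (@le_trans _ _ (\int[mu]_x ((g \_ D) \_ (~` N)) x)); last first.
    apply: ge0_le_integral_nomeas => x; rewrite patchE; case: ifPn => //.
    by rewrite inE /= => /fg' ->.
  rewrite (@ge0_ae_eq_integral _ _ _ mu setT _ ((g \_ D) \_ (~` N)))//.
    by move=> x _; rewrite patchE; case: ifPn.
  exists N; split => // x /= H; apply: contrapT => Nx; apply: H => _.
  by rewrite [RHS]patchE mem_set.
Qed.

End measure_lemmas.

Section density.
Local Open Scope ereal_scope.
Context {d : measure_display} {T : measurableType d} {R : realType}.
Variables (mu : {sigma_finite_measure set T -> \bar R}).
Variables (nu : {finite_measure set T -> \bar R}) (g : T -> R).
Hypotheses (mg : measurable_fun setT g) (g0 : forall x, (0 <= g x)%R).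
Hypothesis nuE : forall A, measurable A -> nu A = \int[mu]_(x in A) (g x)%:E.

(** [nu] is dominated by [mu], and [g] agrees almost everywhere with the Radon-Nikodym derivative
    because both have the same integrals over measurable sets. *)
Lemma ge0_integral_density (f : T -> \bar R) :
  measurable_fun setT f -> (forall x, 0 <= f x) ->
  \int[nu]_x f x = \int[mu]_x (f x * (g x)%:E).
Proof.
move=> mf f0.
have numu : nu `<< mu.
  apply/null_content_dominatesP => A mA muA0; rewrite nuE//.
  apply: null_set_integral => //.
  exact/measurable_EFinP/measurable_funTS.
rewrite -(Radon_Nikodym_SigmaFinite.change_of_variables numu)//.
have mRN : measurable_fun setT (Radon_Nikodym_SigmaFinite.f nu mu).
  exact: measurable_int (Radon_Nikodym_SigmaFinite.f_integrable numu).
have RNg : ae_eq mu setT (Radon_Nikodym_SigmaFinite.f nu mu) (EFin \o g).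
  apply: integral_ae_eq => //.
  - exact: Radon_Nikodym_SigmaFinite.f_integrable.
  - exact/measurable_EFinP.
  - by move=> A _ mA; rewrite -Radon_Nikodym_SigmaFinite.f_integral// nuE.
apply: ge0_ae_eq_integral => //.
- exact: emeasurable_funM.
- by apply: emeasurable_funM => //; exact/measurable_EFinP.
- by move=> x _; rewrite mule_ge0// Radon_Nikodym_SigmaFinite.f_ge0.
- by move=> x _; rewrite mule_ge0// lee_fin.
- by apply: filterS RNg => x /= H _; rewrite H.
Qed.

End density.

Section translation.
Local Open Scope ereal_scope.
Context {R : realType}.
Local Notation mu := (@lebesgue_measure R).

Lemma lebesgue_measure_translation (c : R) (A : set R) : measurable A ->
  pushforward mu (+%R c : _ -> measurableTypeR R) A = mu A.
Proof.
have mc : measurable_fun setT (+%R c : measurableTypeR R -> measurableTypeR R).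
  exact: measurable_funD.
move=> mA; apply/esym/lebesgue_measure_unique => //= _ [[a b]] _ <-.
rewrite /pushforward.
have -> : +%R c @^-1` `]a, b]%classic = `](a - c)%R, (b - c)%R]%classic.
  by apply/seteqP; split => x /=; rewrite !in_itv/= ltrBlDl lerBrDl.
rewrite !lebesgue_measure_itv/= !lte_fin ltrD2r.
by case: ifPn => // _; rewrite -!EFinB opprB addrA subrK.
Qed.

Lemma ge0_integral_translation (c : R) (f : R -> \bar R) :
  measurable_fun setT f -> (forall x, 0 <= f x) ->
  \int[mu]_x f (c + x)%R = \int[mu]_x f x.
Proof.
move=> mf f0.
have mc : measurable_fun setT (+%R c : measurableTypeR R -> measurableTypeR R).
  exact: measurable_funD.
have := @ge0_integral_pushforward _ _ _ _ R _ mc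
  mu setT f measurableT mf (fun y _ => f0 y).
rewrite preimage_setT => <-.
by apply: eq_measure_integral => A mA _; exact: lebesgue_measure_translation.
Qed.

End translation.

(** * Normal distributions *)

Section normal_moments.
Context {R : realType}.
Local Notation mu := (@lebesgue_measure R).
Implicit Types (m s x : R).

Lemma ge0_integral_normal_prob m s (f : R -> \bar R) :
  measurable_fun setT f -> (forall x, (0 <= f x)%E) ->
  (\int[normal_prob m s]_x f x = \int[mu]_x (f x * (normal_pdf m s x)%:E))%E.
Proof.
move=> mf f0.
apply: (@ge0_integral_density _ _ _ mu (normal_prob m s) (normal_pdf m s)) => //.
- exact: measurable_normal_pdf.
- by move=> x; exact: normal_pdf_ge0.
Qed.

Lemma normal_pdf_center m s x : s != 0 ->
  normal_pdf m s x = normal_pdf 0 s (x - m).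
Proof. by move=> s0; rewrite !normal_pdfE// [in LHS]normal_fun_center. Qed.

Lemma normal_pdfN s x : s != 0 -> normal_pdf 0 s (- x) = normal_pdf 0 s x.
Proof. by move=> s0; rewrite !normal_pdfE// /normal_fun !subr0 sqrrN. Qed.

(** The parameter [s] of [gaussian_variable] may be negative, whereas [arcade_density] uses the
    square root of the variance; the density sees only the square. *)
Lemma normal_pdf_sqr m s s' : s != 0 -> s ^+ 2 = s' ^+ 2 ->
  normal_pdf m s = normal_pdf m s'.
Proof.
move=> s0 ss'; have s'0 : s' != 0.
  by apply: contraNneq s0 => s'0; rewrite -sqrf_eq0 ss' s'0 expr0n.
by rewrite !normal_pdfE// /normal_peak /normal_fun ss'.
Qed.

Lemma is_derive_normal_pdf s x : s != 0 ->
  is_derive x 1 (normal_pdf 0 s) (- (x / s ^+ 2 * normal_pdf 0 s x)).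
Proof.
move=> s0.
have fE : normal_pdf 0 s =
   (normal_peak s \*: (expR \o ((- (s ^+ 2 *+ 2)^-1) \*: (fun x => x ^+ 2)))).
  apply/funext => y; rewrite normal_pdfE// /normal_fun subr0 /=; congr (_ * expR _).
  by rewrite /GRing.scale/=; ring.
rewrite fE.
apply: is_derive_eq.
rewrite /= /GRing.scale/= !mulr1.
set e := expR _; set k := normal_peak s. by field.
Qed.

Lemma cvg_normal_pdf s : s != 0 -> normal_pdf 0 s x @[x --> +oo] --> (0 : R).
Proof.
move=> s0.
have -> : normal_pdf 0 s = (fun x => normal_peak s *
    gauss_fun (Num.sqrt (s ^+ 2 *+ 2)^-1 * x)).
  apply/funext => y; rewrite normal_pdfE// /normal_fun subr0 /=; congr (_ * expR _).
  by rewrite exprMn sqr_sqrtr ?invr_ge0 ?mulrn_wge0 ?sqr_ge0//; ring.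
rewrite -[X in _ --> X](mulr0 (normal_peak s)); apply: cvgM; first exact: cvg_cst.
apply: cvg_comp cvg_gauss_fun.
apply: gt0_cvgMry; last exact: cvg_id.
by rewrite sqrtr_gt0 invr_gt0 pmulrn_lgt0 ?exprn_even_gt0.
Qed.

(* Tonelli on [0 <= a <= x] turns the second moment on the half line into the
   integral of the density, as [x / s^2 * pdf x] has primitive [- pdf]. *)
Lemma half_normal_second_moment s : s != 0 ->
  (\int[mu]_(x in `[0%R, +oo[) (x ^+ 2 / s ^+ 2 * normal_pdf 0 s x)%:E =
   \int[mu]_(x in `[0%R, +oo[) (normal_pdf 0 s x)%:E)%E.
Proof.
move=> s0; set f := normal_pdf 0 s.
have f0 x : 0 <= f x by exact: normal_pdf_ge0.
have mf : measurable_fun setT f by exact: measurable_normal_pdf.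
pose k x := x / s ^+ 2 * f x.
have mk : measurable_fun setT k.
  by apply: measurable_funM => //; apply: measurable_funM.
have ck : continuous k.
  move=> x; apply: cvgM; last exact: continuous_normal_pdf.
  by apply: cvgM; [exact: cvg_id|exact: cvg_cst].
have k0 x : 0 <= x -> 0 <= k x.
  by move=> x0; rewrite !mulr_ge0// invr_ge0 sqr_ge0.
have tail a : 0 <= a -> (\int[mu]_(x in `[a, +oo[) (k x)%:E = (f a)%:E)%E.
  move=> a0.
  have dF x : is_derive x 1 (- f) (k x).
    by have ? := is_derive_normal_pdf x s0; apply: is_derive_eq; rewrite opprK.
  rewrite (@ge0_continuous_FTC2y _ k (- f) a 0).
  - by rewrite sub0e -EFinN; congr EFin; exact: opprK.
  - by move=> x ax; apply: k0; exact: le_trans ax.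
  - exact: continuous_subspaceT.
  - by rewrite -oppr0; apply: cvgN; exact: cvg_normal_pdf.
  - by move=> x ax; have := dF x => -[].
  - apply: cvg_at_right_filter; apply: cvgN; exact: continuous_normal_pdf.
  - by move=> x _; rewrite derive1E; have [_ ->] := dF x.
pose h (ax : R * R) : \bar R :=
  if (0 <= ax.1) && (ax.1 <= ax.2) then (k ax.2)%:E else 0%E.
have h0 ax : (0 <= h ax)%E.
  rewrite /h; case: ifPn => // /andP[a0 ax'].
  by rewrite lee_fin k0// (le_trans a0).
have mh : measurable_fun setT h.
  apply: measurable_fun_ifT => //.
    by apply: measurable_and; apply: measurable_fun_ler.
  by apply/measurable_EFinP; apply: measurableT_comp.
have := fubini_tonelli (m1 := mu) (m2 := mu) h mh h0.
rewrite /h /= => hE.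
rewrite integral_mkcond [RHS]integral_mkcond.
transitivity (\int[mu]_x \int[mu]_a h (a, x))%E; last first.
  rewrite -[LHS]hE; apply: eq_integral => a _.
  rewrite patchE mem_setE in_itv/= andbT; case: ifPn => a0.
    rewrite -(tail a a0) [RHS]integral_mkcond; apply: eq_integral => x _.
    by rewrite /= patchE/= mem_setE in_itv/= andbT.
  by rewrite integral0.
apply: eq_integral => x _.
transitivity (\int[mu]_(a in `[0%R, x]) (k x)%:E)%E.
  rewrite (@integral_cst _ _ _ mu `[0%R, x]%classic (measurable_itv _) (k x)%:E).
  rewrite /= lebesgue_measure_itv/= lte_fin.
  rewrite patchE mem_setE in_itv/= andbT.
  case: ltgtP => [x0|x0|<-]; last first.
  - by rewrite expr0n/= mul0r mul0r mule0.
  - by rewrite mule0.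
  - by rewrite oppr0 adde0 -EFinM /k; congr EFin; ring.
rewrite integral_mkcond; apply: eq_integral => a _.
by rewrite patchE mem_setE in_itv.
Qed.


Lemma ge0_integral_reflection (f : R -> \bar R) :
  measurable_fun setT f -> (forall x, (0 <= f x)%E) ->
  (\int[mu]_x f (- x)%R = \int[mu]_x f x)%E.
Proof.
move=> mf f0.
have mN : measurable_fun setT (-%R : measurableTypeR R -> measurableTypeR R).
  exact: oppr_measurable.
have := @ge0_integral_pushforward _ _ _ _ R _ mN
  mu setT f measurableT mf (fun y _ => f0 y).
rewrite preimage_setT => <-.
by apply: eq_measure_integral => A mA _; exact: lebesgue_measureN.
Qed.

Lemma ge0_integral_normal_prob_center m s (f : R -> \bar R) : s != 0 ->
  measurable_fun setT f -> (forall x, (0 <= f x)%E) ->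
  (\int[normal_prob m s]_x f (x - m)%R =
   \int[mu]_x (f x * (normal_pdf 0 s x)%:E))%E.
Proof.
move=> s0 mf f0.
rewrite (@ge0_integral_normal_prob m s (fun x => f (x - m))); last 2 first.
- by apply: measurableT_comp => //; exact: measurable_funB.
- by move=> x.
rewrite -(@ge0_integral_translation _ (- m) (fun x => f x * (normal_pdf 0 s x)%:E)%E).
- by apply: eq_integral => x _; rewrite normal_pdf_center// addrC.
- by apply: emeasurable_funM => //; apply/measurable_EFinP; exact: measurable_normal_pdf.
- by move=> x; rewrite mule_ge0// lee_fin normal_pdf_ge0.
Qed.

(** The integrand is even, so twice the half-line identity gives [s ^+ 2] times the total mass 1 of
    the density. *)
Lemma normal_second_moment m s : s != 0 ->
  (\int[normal_prob m s]_x ((x - m) ^+ 2)%:E = (s ^+ 2)%:E)%E.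
Proof.
move=> s0.
rewrite (@ge0_integral_normal_prob_center m s (fun x => (x ^+ 2)%:E)); last 3 first.
- by [].
- by apply/measurable_EFinP; exact: measurable_funX.
- by move=> x; rewrite lee_fin sqr_ge0.
have mf : measurable_fun setT (normal_pdf 0 s) by exact: measurable_normal_pdf.
transitivity (\int[mu]_x ((s ^+ 2)%:E *
    (x ^+ 2 / s ^+ 2 * normal_pdf 0 s x)%:E))%E.
  apply: eq_integral => x _; rewrite -!EFinM; congr EFin.
  by set g := normal_pdf _ _ _; field.
have f0 x : 0 <= x ^+ 2 / s ^+ 2 * normal_pdf 0 s x.
  by apply: mulr_ge0; [apply: divr_ge0; exact: sqr_ge0|exact: normal_pdf_ge0].
rewrite ge0_integralZl; last 4 first.
- exact: measurableT.
- apply/measurable_EFinP; apply: measurable_funM => //.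
  by apply: measurable_funM => //; exact: measurable_funX.
- by move=> x _; rewrite lee_fin.
- by rewrite lee_fin sqr_ge0.
rewrite ge0_symfun_integralT//; last 2 first.
- move=> x; apply: cvgM; last exact: continuous_normal_pdf.
  by apply: cvgM; [exact: exprn_continuous|exact: cvg_cst].
- by move=> x /=; rewrite sqrrN normal_pdfN.
have -> : [set x : R | 0 <= x] = `[0, +oo[%classic.
  by apply/seteqP; split => x /=; rewrite in_itv/= andbT.
rewrite half_normal_second_moment//.
have := integral_normal_pdf 0 s.
rewrite ge0_symfun_integralT//; last 3 first.
- by move=> x; exact: normal_pdf_ge0.
- exact: continuous_normal_pdf.
- by move=> x /=; rewrite normal_pdfN.
have -> : [set x : R | 0 <= x] = `[0, +oo[%classic.
  by apply/seteqP; split => x /=; rewrite in_itv/= andbT.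
by move=> ->; rewrite mule1.
Qed.

Lemma integrable_normal_sqr m s : s != 0 ->
  (normal_prob m s).-integrable setT (fun x => ((x - m) ^+ 2)%:E).
Proof.
move=> s0; apply/integrableP; split.
  by apply/measurable_EFinP; apply: measurable_funX; exact: measurable_funB.
under eq_integral do rewrite gee0_abs ?lee_fin ?sqr_ge0//.
by rewrite normal_second_moment// ltry.
Qed.

Lemma integrable_normal_id m s : s != 0 ->
  (normal_prob m s).-integrable setT (EFin \o (fun x => x - m)).
Proof.
move=> s0.
apply/(@le_integrable _ _ _ (normal_prob m s) setT measurableT
  (EFin \o (fun x => x - m)) (fun x => (1 + (x - m) ^+ 2)%:E)).
- by apply/measurable_EFinP; exact: measurable_funB.
- move=> x _ /=; rewrite lee_fin [leRHS]ger0_norm ?addr_ge0 ?sqr_ge0//.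
  have := sqr_ge0 (`|x - m| - 1); rewrite sqrrB1 real_normK ?num_real//.
  have := normr_ge0 (x - m); lra.
- under eq_fun do rewrite EFinD.
  apply: integrableD => //; last exact: integrable_normal_sqr.
  exact: finite_measure_integrable_cst.
Qed.

(** Reflection exchanges the positive and negative parts of the centred variable; their common
    integral is finite, so they cancel. *)
Lemma normal_first_moment m s : s != 0 ->
  (\int[normal_prob m s]_x x%:E = m%:E)%E.
Proof.
move=> s0.
have iB := integrable_normal_id m s0.
have c0 : (\int[normal_prob m s]_x (x - m)%:E = 0)%E.
  have mp : measurable_fun setT (EFin^\+ : R -> \bar R)%E.
    exact: measurable_funepos.
  have mn : measurable_fun setT (EFin^\- : R -> \bar R)%E.
    exact: measurable_funeneg.
  rewrite integralE.
  have -> : (\int[normal_prob m s]_x ((fun x => (x - m)%:E)^\+ x) =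
    \int[mu]_x (EFin^\+ x * (normal_pdf 0 s x)%:E))%E.
    rewrite -(ge0_integral_normal_prob_center m s0 mp); last by move=> x; exact: funepos_ge0.
    by apply: eq_integral => x _; rewrite ?funeposE ?funenegE.
  have -> : (\int[normal_prob m s]_x ((fun x => (x - m)%:E)^\- x) =
    \int[mu]_x (EFin^\- x * (normal_pdf 0 s x)%:E))%E.
    rewrite -(ge0_integral_normal_prob_center m s0 mn); last by move=> x; exact: funeneg_ge0.
    by apply: eq_integral => x _; rewrite ?funeposE ?funenegE.
  rewrite -[X in (_ - X)%E]ge0_integral_reflection; last 2 first.
  - by apply: emeasurable_funM => //; apply/measurable_EFinP; exact: measurable_normal_pdf.
  - by move=> x; rewrite mule_ge0// lee_fin normal_pdf_ge0.
  set A := (\int[_]_x _)%E; set B := (\int[_]_x _)%E.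
  have -> : B = A.
    apply: eq_integral => x _; rewrite normal_pdfN//; congr (_ * _)%E.
    by rewrite funenegE funeposE -EFinN opprK.
  rewrite subee// /A -(@ge0_integral_normal_prob_center m s (EFin^\+)%E s0 mp)//.
  apply: (integrable_fin_num measurableT).
  by have := integrable_funepos measurableT iB; rewrite funepos_comp.
transitivity (\int[normal_prob m s]_x ((x - m)%:E + m%:E))%E.
  by apply: eq_integral => x _; rewrite -EFinD subrK.
rewrite integralD//; last exact: finite_measure_integrable_cst.
by rewrite c0 add0e integral_cst//= probability_setT mule1.
Qed.

End normal_moments.

Section gaussian_law.
Context {R : realType} {d : measure_display} {Omega : measurableType d}.
Variables (P : probability Omega R) (X : Omega -> R).
Hypotheses (mX : measurable_fun setT X) (gX : gaussian_variable P X).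
Local Notation mu := (@lebesgue_measure R).

Let X' : Omega -> measurableTypeR R := X.
Let mX' : measurable_fun setT X'. Proof. exact: mX. Qed.

Lemma gaussian_law : (exists m, forall A, measurable A -> pushforward P X' A = \d_m A) \/
  (exists m s, s != 0 /\ forall A, measurable A -> pushforward P X' A = normal_prob m s A).
Proof.
have [m [s H]] := gX; have [s0|s0] := eqVneq s 0.
  by left; exists m => A mA; rewrite /pushforward H// s0 eqxx.
by right; exists m, s; split => // A mA; rewrite /pushforward H// (negbTE s0).
Qed.

Lemma ge0_gaussian_integral (f : R -> \bar R) :
  measurable_fun setT f -> (forall x, (0 <= f x)%E) ->
  (\int[P]_w f (X w) = \int[pushforward P X']_x f x)%E.
Proof.
move=> mf f0.
by rewrite (ge0_integral_pushforward mX' P measurableT mf) ?preimage_setT.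
Qed.

Let msqr (m : R) : measurable_fun setT (fun x : R => ((x - m) ^+ 2)%:E).
Proof.
by apply/measurable_EFinP; apply: measurable_funX; exact: measurable_funB.
Qed.

(** Square integrability is what permits the bilinear expansion of the variance of the arcade
    process. *)
Lemma gaussian_Lfun2 : X \in Lfun P 2%:E.
Proof.
suff : (\int[P]_w (X w ^+ 2)%:E < +oo)%E.
  move=> H; rewrite inE; apply/andP; split; first by rewrite inE.
  rewrite inE /= /finite_norm unlock /Lnorm.
  have -> : (\int[P]_x `|(EFin \o X) x| `^ 2 = \int[P]_w (X w ^+ 2)%:E)%E.
    apply: eq_integral => w _ /=.
    by rewrite powR_mulrn// real_normK// num_real.
  by rewrite poweR_lty.
rewrite (@ge0_gaussian_integral (fun x => (x ^+ 2)%:E)); last 2 first.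
- by have := msqr 0; under eq_fun do rewrite subr0.
- by move=> x; rewrite lee_fin sqr_ge0.
case: gaussian_law => [[m H]|[m [s [s0 H]]]].
  rewrite (eq_measure_integral (dirac m))//; last by move=> A mA _; exact: H.
  rewrite integral_dirac//; last by have := msqr 0; under eq_fun do rewrite subr0.
  by rewrite diracT mul1e ltry.
rewrite (eq_measure_integral (normal_prob m s)); last by move=> A mA _; exact: H.
apply: (@le_lt_trans _ _ (\int[normal_prob m s]_x
   (2%:E * ((x - m) ^+ 2)%:E + (2 * m ^+ 2)%:E))%E).
  apply: ge0_le_integral => //.
  - by move=> x _; rewrite lee_fin sqr_ge0.
  - by have := msqr 0; under eq_fun do rewrite subr0.
  - by apply: emeasurable_funD => //; apply: emeasurable_funM => //; exact: msqr.
  - move=> x _; rewrite -EFinM -EFinD lee_fin.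
    by have := sqr_ge0 (x - 2 * m); rewrite !sqrrB; lra.
apply: (integrable_lty measurableT).
apply: integrableD => //; last exact: finite_measure_integrable_cst.
by apply: integrableZl => //; exact: integrable_normal_sqr.
Qed.

(** The moments identify the law: positive variance excludes the Dirac case, and in the normal case
    mean and variance return [m] and [s ^+ 2]. This connects [gaussian_variable], which only asserts
    some parameters, with a density defined through moments. *)
Lemma gaussian_density (f : R -> \bar R) : (0 < 'V_P[X])%E ->
  measurable_fun setT f -> (forall x, (0 <= f x)%E) ->
  (\int[P]_w f (X w) = \int[mu]_a (f a *
     (normal_pdf (fine 'E_P[X]) (Num.sqrt (fine 'V_P[X])) a)%:E))%E.
Proof.
move=> V0 mf f0; rewrite ge0_gaussian_integral//.
have X1 : X \in Lfun P 1 by apply: Lfun_subset12 gaussian_Lfun2; exact: fin_num_measure.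
have EX : ('E_P[X] = \int[pushforward P X']_x x%:E)%E.
  have iX : P.-integrable (X' @^-1` setT) (EFin \o X').
    by rewrite preimage_setT; exact/Lfun1_integrable.
  have mE : measurable_fun setT (EFin : measurableTypeR R -> \bar R).
    exact/measurable_EFinP.
  rewrite (integral_pushforward mX' mE iX measurableT).
  by rewrite preimage_setT unlock.
have VX : ('V_P[X] = \int[pushforward P X']_x ((x - fine 'E_P[X]) ^+ 2)%:E)%E.
  rewrite -(@ge0_gaussian_integral (fun x => ((x - fine 'E_P[X]) ^+ 2)%:E) (msqr _)); last first.
    by move=> x; rewrite lee_fin sqr_ge0.
  rewrite /variance covariance.unlock; set c := fine _; rewrite expectation.unlock.
  by apply: eq_integral => w _; rewrite expr2.
case: gaussian_law => [[m H]|[m [s [s0 H]]]].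
  have Em : ('E_P[X] = m%:E)%E.
    rewrite EX (eq_measure_integral (dirac m))//; last by move=> A mA _; exact: H.
    by rewrite integral_dirac// diracT mul1e.
  move: V0; rewrite VX Em /= (eq_measure_integral (dirac m))//; last by move=> A mA _; exact: H.
  by rewrite integral_dirac//; [rewrite diracT mul1e subrr expr0n/= ltxx|exact: msqr].
have Em : ('E_P[X] = m%:E)%E.
  rewrite EX (eq_measure_integral (normal_prob m s)); last by move=> A mA _; exact: H.
  exact: normal_first_moment.
have Vs : ('V_P[X] = (s ^+ 2)%:E)%E.
  rewrite VX Em /= (eq_measure_integral (normal_prob m s)); last by move=> A mA _; exact: H.
  exact: normal_second_moment.
rewrite (eq_measure_integral (normal_prob m s)); last by move=> A mA _; exact: H.
rewrite (ge0_integral_normal_prob m s mf f0) Em Vs /=.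
rewrite (@normal_pdf_sqr _ m s (Num.sqrt (s ^+ 2)) s0)//.
by rewrite sqr_sqrtr// sqr_ge0.
Qed.

End gaussian_law.

(** * The arcade process *)

Section variance_of_combination.
Context {R : realType} {d : measure_display} {T : measurableType d}.
Variables (P : probability T R).

Lemma variance_comb3 (X Y Z : T -> R) (a b xx xy xz yy yz zz : R) :
  X \in Lfun P 2%:E -> Y \in Lfun P 2%:E -> Z \in Lfun P 2%:E ->
  covariance P X X = xx%:E -> covariance P X Y = xy%:E ->
  covariance P X Z = xz%:E -> covariance P Y Y = yy%:E ->
  covariance P Y Z = yz%:E -> covariance P Z Z = zz%:E ->
  variance P (fun w => X w - a * Y w - b * Z w) =
  (xx - 2 * a * xy - 2 * b * xz + a ^+ 2 * yy + 2 * a * b * yz + b ^+ 2 * zz)%:E.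
Proof.
move=> X2 Y2 Z2 hxx hxy hxz hyy hyz hzz.
have -> : (fun w => X w - a * Y w - b * Z w) =
    ((X \- a \o* Y) \- b \o* Z).
  by apply/funext => w /=; rewrite [a * _]mulrC [b * _]mulrC.
have Pfin : P setT \is a fin_num := fin_num_measure P _ measurableT.
have aY2 : (a \o* Y) \in Lfun P 2%:E by apply: Lfun_scale => //; rewrite ler1n.
have bZ2 : (b \o* Z) \in Lfun P 2%:E by apply: Lfun_scale => //; rewrite ler1n.
have XaY2 : (X \- a \o* Y) \in Lfun P 2%:E by rewrite rpredB ?lee1n.
have X1 := Lfun_subset12 Pfin X2.
have Y1 := Lfun_subset12 Pfin Y2.
have Z1 := Lfun_subset12 Pfin Z2.
have Zl c U V : U \in Lfun P 2%:E -> V \in Lfun P 2%:E ->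
    covariance P (c \o* U) V = (c%:E * covariance P U V)%E.
  move=> U2 V2; rewrite covarianceZl//; [exact: (Lfun_subset12 Pfin)..|].
  exact: Lfun2_mul_Lfun1.
have Zr c U V : U \in Lfun P 2%:E -> V \in Lfun P 2%:E ->
    covariance P U (c \o* V) = (c%:E * covariance P U V)%E.
  by move=> U2 V2; rewrite covarianceC Zl// covarianceC.
have W2 : ((X \- a \o* Y) \- b \o* Z) \in Lfun P 2%:E by rewrite rpredB ?lee1n.
rewrite /variance (covarianceBl XaY2 bZ2 W2) (covarianceBr XaY2 XaY2 bZ2).
rewrite (covarianceBr bZ2 XaY2 bZ2) (covarianceBl X2 aY2 XaY2).
rewrite (covarianceBr X2 X2 aY2) (covarianceBr aY2 X2 aY2).
rewrite (covarianceBl X2 aY2 bZ2) (covarianceBr bZ2 X2 aY2).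
rewrite !(Zl, Zr)// hxx hxy hxz hyy hyz hzz.
rewrite (covarianceC P Y X) hxy (covarianceC P Z X) hxz (covarianceC P Z Y) hyz.
by rewrite -!(EFinM, EFinB, EFinN, EFinD); congr EFin; ring.
Qed.

End variance_of_combination.

Section arcade.
Context {R : realType} {d : measure_display} {Omega : measurableType d}.
Variables (P : probability Omega R) (T0 T1 : R) (H1 H2 : R -> R).
Variables (D : R -> {RV P >-> R}) (g0 : R -> R).
Hypotheses (hT01 : T0 < T1) (hrap : standard_rap T0 T1 H1 H2 D g0).
Local Notation f0 := (std_f0 T0 T1 H1 H2).
Local Notation f1 := (std_f1 T0 T1 H1 H2).
Local Notation A := (arcade T0 T1 H1 H2 D).
Local Notation den := (H1 T1 * H2 T0 - H1 T0 * H2 T1).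

Lemma T0_in : T0 \in `[T0, T1]. Proof. by rewrite in_itv/= lexx ltW. Qed.
Lemma T1_in : T1 \in `[T0, T1]. Proof. by rewrite in_itv/= lexx ltW. Qed.

Lemma measurable_arcade t : measurable_fun setT (A t).
Proof.
by apply: measurable_funB; [apply: measurable_funB => //|];
  apply: measurable_funM.
Qed.

Lemma gaussian_driver t : t \in `[T0, T1] -> gaussian_variable P (D t).
Proof.
move=> tT.
have G : gaussian_process T0 T1 D := driver_gaussian (rap_driver hrap).
have := G 1%N (fun=> t) (fun=> 1) (fun=> tT).
rewrite (_ : (fun w => _) = D t)//.
by apply/funext => w; rewrite big_ord1 mul1r.
Qed.

Lemma driver_Lfun2 t : t \in `[T0, T1] -> (D t : Omega -> R) \in Lfun P 2%:E.
Proof. by move=> tT; apply: gaussian_Lfun2 => //; exact: gaussian_driver. Qed.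

Lemma gaussian_arcade t : t \in `[T0, T1] -> gaussian_variable P (A t).
Proof.
move=> tT.
have G : gaussian_process T0 T1 D := driver_gaussian (rap_driver hrap).
have := G 3%N
  (fun i : 'I_3 => [:: t; T0; T1]`_i) (fun i => [:: 1; - f0 t; - f1 t]`_i).
rewrite (_ : (fun w => _) = A t); last first.
  apply/funext => w; rewrite !big_ord_recl big_ord0 /= /arcade.
  by rewrite mul1r !mulNr addr0 addrA.
apply => -[[|[|[|//]]] i] /=; [exact: tT|exact: T0_in|exact: T1_in].
Qed.

(** Since the inverse of 0 is 0 by convention, a vanishing denominator would make [std_f0]
    identically zero, against its value 1 at [T0]. *)
Lemma den_neq0 : den != 0.
Proof.
have [_ _ [f00 _] _] := rap_f hrap.
apply: contra_eq_neq f00 => den0.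
by rewrite /std_f0 den0 invr0 mulr0 eq_sym oner_neq0.
Qed.

(** The product form of the driver covariance makes the six terms collapse. The closed form gives
    measurability in time of the standard deviation and, through the assumed positivity of the
    variance, the signs of all three factors. *)
Lemma variance_arcade t : t \in `[T0, T1] ->
  ('V_P[A t] = (f0 t * f1 t * den)%:E)%E.
Proof.
move=> tT.
have cov s u : s \in `[T0, T1] -> u \in `[T0, T1] -> s <= u ->
    covariance P (D s) (D u) = (H1 s * H2 u)%:E.
  move=> sT uT su; rewrite (driver_covariance (rap_driver hrap))//.
  by rewrite (min_idPl su) (max_idPr su).
have T0T := T0_in; have T1T := T1_in.
have [T0t tT1] : T0 <= t /\ t <= T1 by move: tT; rewrite in_itv => /andP[].
have c0 : covariance P (D t) (D T0) = (H1 T0 * H2 t)%:E.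
  by rewrite covarianceC; exact: cov.
rewrite (@variance_comb3 _ _ _ _ _ _ _ (f0 t) (f1 t) _ _ _ _ _ _ (driver_Lfun2 tT)
  (driver_Lfun2 T0T) (driver_Lfun2 T1T) (cov _ _ tT tT (lexx t)) c0 (cov _ _ tT T1T tT1)
  (cov _ _ T0T T0T (lexx _)) (cov _ _ T0T T1T (ltW hT01)) (cov _ _ T1T T1T (lexx _))).
have := den_neq0; rewrite /std_f0 /std_f1 => d0; congr EFin; field.
exact: d0.
Qed.

Lemma continuous_std_f0 : {within `[T0, T1], continuous f0}.
Proof. by have [] := rap_f hrap. Qed.

Lemma continuous_std_f1 : {within `[T0, T1], continuous f1}.
Proof. by have [] := rap_f hrap. Qed.

(** The linear relation defining the standard coefficients is inverted, so that [H1] and [H2]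
    inherit the continuity of [std_f0] and [std_f1]; almost everywhere differentiability would not
    give it. *)
Lemma std_H1 t : H1 t = f0 t * H1 T0 + f1 t * H1 T1.
Proof. by have := den_neq0; rewrite /std_f0 /std_f1 => d0; field. Qed.

Lemma std_H2 t : H2 t = f0 t * H2 T0 + f1 t * H2 T1.
Proof. by have := den_neq0; rewrite /std_f0 /std_f1 => d0; field. Qed.

Lemma std_prod_gt0 t : t \in `]T0, T1[ -> 0 < f0 t * f1 t * den.
Proof.
move=> tT; have := rap_nondegenerate hrap tT.
by rewrite variance_arcade ?lte_fin// subset_itv_oo_cc.
Qed.

(** The coefficient starts at 1 and cannot cross 0 inside the interval, since the variance of the
    arcade process would vanish there. *)
Lemma std_f0_gt0 t : t \in `]T0, T1[ -> 0 < f0 t.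
Proof.
move=> tT; rewrite ltNge; apply/negP => ft.
have /andP[T0t tT1] : T0 < t < T1 by rewrite in_itv in tT.
have [_ _ [f00 _] _] := rap_f hrap.
have cf : {within `[T0, t], continuous f0}.
  apply: continuous_subspaceW continuous_std_f0.
  by apply: subset_itvl; rewrite bnd_simp ltW.
have [|c] := @IVT _ f0 T0 t 0 (ltW T0t) cf.
  by rewrite f00 ge_min le_max ler01 ft/= orbT.
rewrite in_itv/= => /andP[T0c ct] fc.
have cT : c \in `]T0, T1[.
  rewrite in_itv/= (le_lt_trans ct tT1) andbT lt_neqAle T0c andbT.
  by apply/eqP => cE; move: fc; rewrite -cE f00 => /eqP; rewrite oner_eq0.
by have := std_prod_gt0 cT; rewrite fc !mul0r ltxx.
Qed.

Lemma std_f1_gt0 t : t \in `]T0, T1[ -> 0 < f1 t.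
Proof.
move=> tT; rewrite ltNge; apply/negP => ft.
have /andP[T0t tT1] : T0 < t < T1 by rewrite in_itv in tT.
have [_ _ _ [_ f11]] := rap_f hrap.
have cf : {within `[t, T1], continuous f1}.
  apply: continuous_subspaceW continuous_std_f1.
  by apply: subset_itvr; rewrite bnd_simp ltW.
have [|c] := @IVT _ f1 t T1 0 (ltW tT1) cf.
  by rewrite f11 ge_min le_max ler01 ft/= orbT.
rewrite in_itv/= => /andP[tc cT1] fc.
have cT : c \in `]T0, T1[.
  rewrite in_itv/= (lt_le_trans T0t tc)/= lt_neqAle cT1 andbT.
  by apply/eqP => cE; move: fc; rewrite cE f11 => /eqP; rewrite oner_eq0.
by have := std_prod_gt0 cT; rewrite fc mulr0 mul0r ltxx.
Qed.

Lemma den_gt0 : 0 < den.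
Proof.
have mT : (T0 + T1) / 2 \in `]T0, T1[ by rewrite in_itv/=; apply/andP; split; move: hT01; lra.
have := std_prod_gt0 mT; rewrite pmulr_rgt0//.
by apply: mulr_gt0; [exact: std_f0_gt0|exact: std_f1_gt0].
Qed.

(** The denominator of the weight is the numerator of [std_f0 t]; it is positive because [std_f0 t]
    and its denominator are. *)
Lemma weight_ge0 t : t \in `]T0, T1[ -> 0 <= weight T1 H1 H2 t.
Proof.
move=> tT; rewrite /weight divr_ge0 ?sqrtr_ge0//.
have := std_f0_gt0 tT; rewrite /std_f0 pmulr_lgt0 ?invr_gt0 ?den_gt0//.
exact: ltW.
Qed.

End arcade.

(** * Measurable versions of derivatives and of the weight *)

Section derivative_version.
Context {R : realType}.
Local Notation mu := (@lebesgue_measure R).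

(** The upper limit of the difference quotients with steps 1/(n+1) is measurable everywhere and
    equals the derivative wherever that exists. *)
Lemma measurable_derive1_version (a b : R) (H : R -> R) :
  {within `[a, b], continuous H} ->
  exists2 h : R -> R, measurable_fun setT h &
    forall t, t \in `]a, b[ -> derivable H t 1 -> derive1 H t = h t.
Proof.
move=> cH.
pose Hp := H \_ `[a, b].
have mHp : measurable_fun setT Hp.
  apply/(measurable_restrictT H (measurable_itv _)).
  exact: subspace_continuous_measurable_fun.
pose u n t := n.+1%:R * (Hp (n.+1%:R^-1 + t) - Hp t).
have mu_ n : measurable_fun setT (u n).
  apply: measurable_funM => //; apply: measurable_funB => //.
  by apply: measurableT_comp => //; exact: measurable_funD.
exists (fun t => fine (limn_esup (fun n => (u n t)%:E))).
  apply: measurableT_comp => //.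
  by apply: measurable_fun_limn_esup => n; exact/measurable_EFinP.
move=> t; rewrite in_itv/= => /andP[at_ tb] dH.
have cu : (u n t)%:E @[n --> \oo] --> (derive1 H t)%:E.
  apply: cvg_EFin; first exact: nearW.
  have dH' : (fun h => h^-1 *: (H (h + t) - H t)) @ 0^' --> derive1 H t.
    have := dH; rewrite /derivable; under eq_fun do rewrite scaler1.
    by move=> /cvgP.
  have := (cvgr_dnbhsP _ _ _).1 dH' (@harmonic R).
  have h0 : (forall n, harmonic n != 0 :> R) /\ @harmonic R n @[n --> \oo] --> 0.
    by split; [move=> n; rewrite gt_eqF// harmonic_gt0|exact: cvg_harmonic].
  move=> /(_ h0); apply: cvg_trans; apply: near_eq_cvg.
  (* Once 1/(n+1) is below [b - t], both points of the quotient lie in [a, b], where the extension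
     by zero [Hp] coincides with [H]. *)
  have bt : 0 < b - t by rewrite subr_gt0.
  have : \forall n \near \oo, `|@harmonic R n| < b - t.
    by apply: cvgr0_norm_lt => //; exact: h0.2.
  apply: filterS => n /=; rewrite ger0_norm ?harmonic_ge0// => hn.
  rewrite /u /Hp !patchE !ifT; last 2 first.
  - by rewrite inE/= in_itv/= !ltW.
  - rewrite inE/= in_itv/= (le_trans (ltW at_)) ?lerDr ?invr_ge0//=.
    by rewrite -lerBrDr ltW.
  by rewrite /harmonic/= invrK.
by have [_ ->] := cvg_limn_einf_sup cu.
Qed.

End derivative_version.

Section weight_version.
Context {R : realType} {d : measure_display} {Omega : measurableType d}.
Variables (P : probability Omega R) (T0 T1 : R) (H1 H2 : R -> R).
Variables (D : R -> {RV P >-> R}) (g0 : R -> R).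
Hypotheses (hT01 : T0 < T1) (hrap : standard_rap T0 T1 H1 H2 D g0).
Local Notation f0 := (std_f0 T0 T1 H1 H2).
Local Notation f1 := (std_f1 T0 T1 H1 H2).
Local Notation mu := (@lebesgue_measure R).

Lemma continuous_H1 : {within `[T0, T1], continuous H1}.
Proof.
have -> : H1 = (fun t => f0 t * H1 T0 + f1 t * H1 T1).
  by apply/funext => t; exact: std_H1 hrap t.
move=> t; apply: cvgD; apply: cvgM; first exact: continuous_std_f0 hrap t.
- exact: cvg_cst.
- exact: continuous_std_f1 hrap t.
- exact: cvg_cst.
Qed.

Lemma continuous_H2 : {within `[T0, T1], continuous H2}.
Proof.
have -> : H2 = (fun t => f0 t * H2 T0 + f1 t * H2 T1).
  by apply/funext => t; exact: std_H2 hrap t.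
move=> t; apply: cvgD; apply: cvgM; first exact: continuous_std_f0 hrap t.
- exact: cvg_cst.
- exact: continuous_std_f1 hrap t.
- exact: cvg_cst.
Qed.

Lemma measurable_restrict_continuous (f : R -> R) :
  {within `[T0, T1], continuous f} -> measurable_fun `]T0, T1[ f.
Proof.
move=> cf; apply: subspace_continuous_measurable_fun => //.
apply: continuous_subspaceW cf; exact: subset_itv_oo_cc.
Qed.

Lemma measurable_std_f0_inv : measurable_fun `]T0, T1[ (fun t => (f0 t)^-1).
Proof.
apply: open_continuous_measurable_fun; first exact: interval_open.
move=> t; rewrite inE => tT; apply: cvgV.
  by rewrite gt_eqF// (std_f0_gt0 hT01 hrap).
exact: within_continuous_continuous hT01 (continuous_std_f0 hrap) tT.
Qed.

(* The pointwise derivatives in [weight] need not be Borel: [derive1] is a junk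
   value where the derivative does not exist. *)
Lemma measurable_weight_version : exists W : R -> R,
  [/\ measurable_fun setT W, forall t, 0 <= W t,
      forall t, t \notin `]T0, T1[ -> W t = 0 &
      ae_eq mu `]T0, T1[%classic (weight T1 H1 H2) W].
Proof.
have [h1 mh1 H1h] := measurable_derive1_version continuous_H1.
have [h2 mh2 H2h] := measurable_derive1_version continuous_H2.
have mH1 := measurable_restrict_continuous continuous_H1.
have mH2 := measurable_restrict_continuous continuous_H2.
(* The denominator of the weight is written as [std_f0 t] times a constant, because the inverse of
   [std_f0] is continuous on the open interval. *)
pose w t := Num.sqrt (h1 t * H2 t - H1 t * h2 t) *
  ((f0 t)^-1 / (H1 T1 * H2 T0 - H1 T0 * H2 T1)).
have mw : measurable_fun `]T0, T1[ w.
  apply: measurable_funM.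
    apply: measurableT_comp; first by apply: continuous_measurable_fun; exact: sqrt_continuous.
    apply: measurable_funB; apply: measurable_funM => //; exact: measurable_funTS.
  apply: measurable_funM => //; exact: measurable_std_f0_inv.
(* Extending by zero lets time range over the whole line, so that time and space can be integrated
   against one product measure. *)
exists (w \_ `]T0, T1[); split.
- exact/(measurable_restrictT w (measurable_itv _)).
- move=> t; rewrite patchE; case: ifPn => //; rewrite inE/= => tT.
  apply: mulr_ge0; first exact: sqrtr_ge0.
  apply: divr_ge0; last exact/ltW/(den_gt0 hT01 hrap).
  by rewrite invr_ge0 ltW// (std_f0_gt0 hT01 hrap).
- by move=> t tT; rewrite patchE memNset//=; exact/negP.
- have := driver_H1 (rap_driver hrap); have := driver_H2 (rap_driver hrap).
  have FF : Filter (almost_everywhere mu) by exact: ae_filter_ringOfSetsType.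
  apply: filterS2 => t /= d2 d1 tT; rewrite patchE mem_set//.
  have tTc := subset_itv_oo_cc tT.
  rewrite /weight /w -(H1h t tT (d1 tTc)) -(H2h t tT (d2 tTc)); congr (_ * _).
  rewrite /std_f0 invfM invrK mulfK//.
  exact: den_neq0 hrap.
Qed.

End weight_version.

(** * The objective as a concave functional of the weights *)

Section weighted_variance.
Context {R : realFieldType} {m : nat}.
Implicit Types (k : 'I_m -> R) (y : 'I_m -> R).

Let wmean k y := (\sum_j y j * k j) / (\sum_j k j).

(** Parallel-axis identity: the weighted deviations from the mean sum to zero, which kills the cross
    term. *)
Lemma weighted_variance_shift k y c : \sum_j k j != 0 ->
  \sum_j k j * (y j - c) ^+ 2 =
  \sum_j k j * (y j - wmean k y) ^+ 2 + (\sum_j k j) * (wmean k y - c) ^+ 2.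
Proof.
move=> S0; set M := wmean k y.
have MS : \sum_j k j * (y j - M) = 0.
  under eq_bigr do rewrite mulrBr.
  rewrite sumrB -mulr_suml /M /wmean mulrCA divff// mulr1.
  by apply/eqP; rewrite subr_eq0; apply/eqP; apply: eq_bigr => j _; rewrite mulrC.
transitivity (\sum_j (k j * (y j - M) ^+ 2 + k j * (M - c) ^+ 2 +
    2 * (M - c) * (k j * (y j - M)))).
  by apply: eq_bigr => j _; ring.
by rewrite !big_split/= -mulr_sumr MS mulr0 addr0 mulr_suml.
Qed.

Lemma weighted_variance_min k y c : 0 < \sum_j k j ->
  \sum_j k j * (y j - wmean k y) ^+ 2 <= \sum_j k j * (y j - c) ^+ 2.
Proof.
move=> S0; rewrite (weighted_variance_shift y c) ?gt_eqF// lerDl.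
by rewrite mulr_ge0 ?sqr_ge0// ltW.
Qed.

(** One-point update of a sum of squares. The parallel-axis identity is applied to the new weights
    around the old mean, and the new mean differs from the old one by [h / (S + h)] times the
    deviation of [y j], with [S] the old total mass. *)
Lemma weighted_variance_add k y j h : 0 < \sum_i k i -> 0 < \sum_i k i + h ->
  let k' i := k i + (i == j)%:R * h in
  \sum_i k' i * (y i - wmean k' y) ^+ 2 =
  \sum_i k i * (y i - wmean k y) ^+ 2 +
  h * (y j - wmean k y) ^+ 2 * ((\sum_i k i) / (\sum_i k i + h)).
Proof.
move=> S0 Sh0 k'.
have dirac F : \sum_i (i == j)%:R * h * F i = h * F j.
  rewrite (bigD1 j)//= big1 ?addr0 ?eqxx ?mul1r// => i /negbTE ->.
  by rewrite !mul0r.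
have S' : \sum_i k' i = \sum_i k i + h.
  rewrite big_split/=; congr (_ + _).
  by rewrite -[RHS]mulr1 -(dirac (fun=> 1)); apply: eq_bigr => i _; rewrite mulr1.
have T' : \sum_i y i * k' i = \sum_i y i * k i + y j * h.
  under eq_bigr do rewrite mulrDr.
  rewrite big_split/=; congr (_ + _).
  by rewrite [RHS]mulrC -dirac; apply: eq_bigr => i _; rewrite mulrC.
have V' : \sum_i k' i * (y i - wmean k y) ^+ 2 =
    \sum_i k i * (y i - wmean k y) ^+ 2 + h * (y j - wmean k y) ^+ 2.
  under eq_bigr do rewrite mulrDl.
  by rewrite big_split/= dirac.
have := weighted_variance_shift (k := k') y (wmean k y).
rewrite S' gt_eqF// => /(_ isT); rewrite V' => V.
have -> : \sum_i k' i * (y i - wmean k' y) ^+ 2 =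
  \sum_i k i * (y i - wmean k y) ^+ 2 + h * (y j - wmean k y) ^+ 2 -
   (\sum_i k i + h) * (wmean k' y - wmean k y) ^+ 2 by rewrite V addrK.
have -> : wmean k' y = (\sum_i y i * k i + y j * h) / (\sum_i k i + h).
  by rewrite /wmean T' S'.
rewrite /wmean; move: S0 Sh0.
set S := \sum_i k i; set T := \sum_i y i * k i => S0 Sh0.
set V0 := \sum_i _; rewrite -!addrA; congr (_ + _).
have S1 : S != 0 by rewrite gt_eqF.
have Sh1 : S + h != 0 by rewrite gt_eqF.
by field; rewrite S1 Sh1.
Qed.

End weighted_variance.

Section mixture_functional.
Context {R : realType} {d : measure_display} {T : measurableType d}.
Variables (mu : {measure set T -> \bar R}) (l m : nat).
Variables (y : 'I_m -> R) (W : T -> R) (rho : 'I_l -> 'I_m -> T -> R).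
Hypotheses (mW : measurable_fun setT W) (W0 : forall u, 0 <= W u).
Hypotheses (mrho : forall i j, measurable_fun setT (rho i j)).
Hypotheses (rho0 : forall i j u, 0 < rho i j u).
Implicit Types p q : 'M[R]_(l, m).

Definition row_mass p i u := \sum_j rho i j u * p i j.

Definition posterior_mean p i u :=
  (\sum_j y j * rho i j u * p i j) / row_mass p i u.

Definition sqdev p i j u := W u * (rho i j u * (y j - posterior_mean p i u) ^+ 2).

(** The candidate partial derivative in the entry (i, j), with the time weight included; a priori it
    may be infinite. *)
Definition mean_sqdev p i j : \bar R := (\int[mu]_u (sqdev p i j u)%:E)%E.

Definition mixture_functional p : \bar R :=
  (\int[mu]_u (\sum_i \sum_j p i j * sqdev p i j u)%:E)%E.

(** These conditions keep all posterior denominators positive, hold for couplings, and are stable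
    under adding mass to an entry, as the difference quotients require. *)
Definition proper_weights p := (forall i j, 0 <= p i j) /\ forall i, 0 < \sum_j p i j.

Lemma row_mass_gt0 p i u : proper_weights p -> 0 < row_mass p i u.
Proof.
move=> [p0 /(_ i) ps0].
rewrite lt_neqAle sumr_ge0 ?andbT; last first.
  by move=> j _; rewrite mulr_ge0// ltW.
apply: contraTneq ps0 => /esym/eqP; rewrite psumr_eq0; last first.
  by move=> j _; rewrite mulr_ge0// ltW.
move=> /allP H; rewrite big1 ?ltxx// => j _.
have := H j; rewrite mem_index_enum => /(_ isT) /=.
by rewrite mulf_eq0 (gt_eqF (rho0 i j u))/= => /eqP.
Qed.

Lemma measurable_row_mass p i : measurable_fun setT (row_mass p i).
Proof. by apply: measurable_sum => j; apply: measurable_funM. Qed.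

Lemma measurable_fun_inv_gt0 (f : T -> R) : measurable_fun setT f ->
  (forall u, 0 < f u) -> measurable_fun setT (fun u => (f u)^-1).
Proof.
move=> mf f0; rewrite (_ : (fun _ => _) = (fun u => f u `^ (- 1))).
  exact: (measurableT_comp (measurable_powR (- 1)) mf).
by apply/funext => u; rewrite powR_inv1// ltW.
Qed.

Lemma measurable_posterior_mean p i : proper_weights p ->
  measurable_fun setT (posterior_mean p i).
Proof.
move=> pw; apply: measurable_funM.
  by apply: measurable_sum => j; do 2! apply: measurable_funM => //.
apply: measurable_fun_inv_gt0; first exact: measurable_row_mass.
by move=> u; exact: row_mass_gt0.
Qed.

Lemma sqdev_ge0 p i j u : 0 <= sqdev p i j u.
Proof. by rewrite /sqdev mulr_ge0// mulr_ge0 ?sqr_ge0// ltW. Qed.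

Lemma measurable_sqdev p i j : proper_weights p -> measurable_fun setT (sqdev p i j).
Proof.
move=> pw; apply: measurable_funM => //; apply: measurable_funM => //.
by apply: measurable_funX; apply: measurable_funB => //; exact: measurable_posterior_mean.
Qed.

(** With the posterior mean frozen at [p], the integral is linear in [q]; nonnegativity justifies
    exchanging sum and integral even when values are infinite. *)
Lemma mixture_functionalE p q : proper_weights p -> (forall i j, 0 <= q i j) ->
  (\int[mu]_u (\sum_i \sum_j q i j * sqdev p i j u)%:E =
   \sum_i \sum_j (q i j)%:E * mean_sqdev p i j)%E.
Proof.
move=> pw q0.
have mqs i j : measurable_fun setT (fun u => (q i j * sqdev p i j u)%:E).
  by apply/measurable_EFinP; apply: measurable_funM => //; exact: measurable_sqdev.
under eq_integral do rewrite -sumEFin.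
rewrite ge0_integral_sum//; last 2 first.
- move=> i; under eq_fun do rewrite -sumEFin.
  exact: emeasurable_sum.
- move=> i u _; rewrite lee_fin sumr_ge0// => j _.
  by rewrite mulr_ge0// sqdev_ge0.
apply: eq_bigr => i _.
under eq_integral do rewrite -sumEFin.
rewrite ge0_integral_sum//; last first.
  by move=> j u _; rewrite lee_fin mulr_ge0// sqdev_ge0.
apply: eq_bigr => j _.
under eq_integral do rewrite EFinM.
rewrite ge0_integralZl//.
- by apply/measurable_EFinP; exact: measurable_sqdev.
- by move=> u _; rewrite lee_fin sqdev_ge0.
- by rewrite lee_fin.
Qed.

Lemma mixture_functional_self p : proper_weights p ->
  mixture_functional p = (\sum_i \sum_j (p i j)%:E * mean_sqdev p i j)%E.
Proof. by move=> pw; rewrite -mixture_functionalE//; case: pw. Qed.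

Lemma measurable_total_sqdev p q : proper_weights p ->
  measurable_fun setT (fun u => \sum_i \sum_j q i j * sqdev p i j u).
Proof.
move=> pw; do 2! apply: measurable_sum => ?.
by apply: measurable_funM => //; exact: measurable_sqdev.
Qed.

Let sum_sqdev p q i u : \sum_j q i j * sqdev p i j u =
  W u * \sum_j rho i j u * q i j * (y j - posterior_mean p i u) ^+ 2.
Proof. by rewrite mulr_sumr; apply: eq_bigr => j _; rewrite /sqdev; ring. Qed.

Let posterior_meanE p i u : posterior_mean p i u =
  (\sum_j y j * (rho i j u * p i j)) / \sum_j rho i j u * p i j.
Proof. by congr (_ / _); apply: eq_bigr => j _; rewrite mulrA. Qed.

(* Concavity: the posterior mean for [q] minimises the [q]-weighted deviations,
   so replacing it by the one for [p] gives a linear majorant tangent at [p]. *)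
Lemma mixture_functional_le p q : proper_weights p -> proper_weights q ->
  (mixture_functional q <= \sum_i \sum_j (q i j)%:E * mean_sqdev p i j)%E.
Proof.
move=> pw qw; rewrite -mixture_functionalE//; last by case: qw.
have q0 : forall i j, 0 <= q i j by case: qw.
apply: ge0_le_integral => //.
- move=> u _; rewrite lee_fin; apply: sumr_ge0 => i _; apply: sumr_ge0 => j _.
  by rewrite mulr_ge0// sqdev_ge0.
- by apply/measurable_EFinP; exact: measurable_total_sqdev.
- by apply/measurable_EFinP; exact: measurable_total_sqdev.
- move=> u _; rewrite lee_fin; apply: ler_sum => i _.
  rewrite !sum_sqdev ler_wpM2l// [in leLHS]posterior_meanE.
  by apply: weighted_variance_min; exact: row_mass_gt0.
Qed.

(** Pointwise difference quotient for adding mass [h] to one entry: the squared deviation, damped by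
    a factor that increases to 1 as [h] decreases to 0. *)
Let gain p i0 j0 h u := sqdev p i0 j0 u *
    (row_mass p i0 u / (row_mass p i0 u + h * rho i0 j0 u)).

(** Posterior means are computed row by row, so only row [i0] changes; there the one-point update
    applies with added mass [h * rho i0 j0 u]. *)
Let total_sqdev_add p i0 j0 h u : proper_weights p -> 0 < h ->
  let p' := p + h *: delta_mx i0 j0 in
  \sum_i \sum_j p' i j * sqdev p' i j u =
  \sum_i \sum_j p i j * sqdev p i j u + h * gain p i0 j0 h u.
Proof.
move=> pw h0 p'.
have p'E i j : p' i j = p i j + h * ((i == i0) && (j == j0))%:R by rewrite !mxE.
have same i : i != i0 -> \sum_j p' i j * sqdev p' i j u = \sum_j p i j * sqdev p i j u.
  move=> /negbTE ii0.
  have p'i j : p' i j = p i j by rewrite p'E ii0/= mulr0 addr0.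
  apply: eq_bigr => j _; rewrite p'i /sqdev /posterior_mean /row_mass.
  by congr (_ * (_ * (_ * (_ - _ / _) ^+ 2))); apply: eq_bigr => k _; rewrite p'i.
rewrite (bigD1 i0)//= [in RHS](bigD1 i0)//= (eq_bigr _ same) -!addrA.
rewrite [X in _ = _ + X]addrC addrA; congr (_ + _).
rewrite !sum_sqdev !posterior_meanE.
pose k j := rho i0 j u * p i0 j.
have k'E j : rho i0 j u * p' i0 j = k j + (j == j0)%:R * (h * rho i0 j0 u).
  rewrite p'E eqxx/= mulrDr /k; congr (_ + _).
  by have [->|_] := eqVneq j j0; rewrite ?(mulr1, mulr0, mul0r, mul1r)// mulrC.
have k0 : 0 < \sum_j k j by exact: row_mass_gt0.
have kh0 : 0 < \sum_j k j + h * rho i0 j0 u by rewrite addr_gt0// mulr_gt0.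
have := weighted_variance_add y j0 k0 kh0.
rewrite /= => E.
rewrite /gain /sqdev posterior_meanE -/(row_mass p i0 u) -/k.
transitivity (W u * (\sum_i (k i + (i == j0)%:R * (h * rho i0 j0 u)) *
      (y i - (\sum_j y j * (k j + (j == j0)%:R * (h * rho i0 j0 u))) /
        \sum_j (k j + (j == j0)%:R * (h * rho i0 j0 u))) ^+ 2)).
  congr (_ * _); apply: eq_bigr => j _; rewrite k'E.
  by congr (_ * (_ - _ / _) ^+ 2); apply: eq_bigr => i _; rewrite k'E.
rewrite E /row_mass -/k; ring.
Qed.

Let gain_ge0 p i0 j0 h u : proper_weights p -> 0 < h -> 0 <= gain p i0 j0 h u.
Proof.
move=> pw h0; rewrite mulr_ge0 ?sqdev_ge0// divr_ge0//.
  by rewrite ltW// row_mass_gt0.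
by rewrite addr_ge0// ltW ?row_mass_gt0// mulr_gt0.
Qed.

Let measurable_gain p i0 j0 h : proper_weights p -> 0 < h ->
  measurable_fun setT (gain p i0 j0 h).
Proof.
move=> pw h0; apply: measurable_funM; first exact: measurable_sqdev.
apply: measurable_funM; first exact: measurable_row_mass.
apply: measurable_fun_inv_gt0.
  by apply: measurable_funD; [exact: measurable_row_mass|exact: measurable_funM].
by move=> u; rewrite addr_gt0 ?row_mass_gt0// mulr_gt0.
Qed.

Let mixture_functional_add p i0 j0 h : proper_weights p -> 0 < h ->
  mixture_functional (p + h *: delta_mx i0 j0) =
  (mixture_functional p + h%:E * \int[mu]_u (gain p i0 j0 h u)%:E)%E.
Proof.
move=> pw h0; rewrite /mixture_functional.
under eq_integral do rewrite total_sqdev_add// EFinD EFinM.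
rewrite ge0_integralD//.
- congr (_ + _)%E; rewrite ge0_integralZl//.
  + by apply/measurable_EFinP; exact: measurable_gain.
  + by move=> u _; rewrite lee_fin gain_ge0.
  + by rewrite lee_fin ltW.
- move=> u _; rewrite lee_fin; apply: sumr_ge0 => i _; apply: sumr_ge0 => j _.
  by rewrite mulr_ge0 ?sqdev_ge0//; case: pw.
- by apply/measurable_EFinP; exact: measurable_total_sqdev.
- by move=> u _; rewrite -EFinM lee_fin mulr_ge0 ?gain_ge0// ltW.
- by apply/measurable_EFinP; apply: measurable_funM => //; exact: measurable_gain.
Qed.

(** Along [h] = 1/(n+1) the damping factor is nondecreasing in [n], so no integrable majorant is
    needed and an infinite limit is allowed. *)
Let cvg_gain p i0 j0 : proper_weights p ->
  (\int[mu]_u (gain p i0 j0 (harmonic n) u)%:E @[n --> \oo] -->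
   mean_sqdev p i0 j0)%E.
Proof.
move=> pw.
have cvg_pt u : (gain p i0 j0 (harmonic n) u)%:E @[n --> \oo] --> (sqdev p i0 j0 u)%:E.
  apply: cvg_EFin; first exact: nearW.
  have S0 := row_mass_gt0 i0 u pw.
  rewrite -[X in _ --> X]mulr1; apply: cvgM; first exact: cvg_cst.
  rewrite -[X in _ --> X](@divff _ (row_mass p i0 u)) ?gt_eqF//.
  apply: cvgM; first exact: cvg_cst.
  apply: cvgV; first by rewrite gt_eqF.
  rewrite -[X in _ --> X]addr0; apply: cvgD; first exact: cvg_cst.
  rewrite -[X in _ --> X](mul0r (rho i0 j0 u)); apply: cvgM; last exact: cvg_cst.
  exact: cvg_harmonic.
have -> : mean_sqdev p i0 j0 = (\int[mu]_u limn
    (fun n => (gain p i0 j0 (harmonic n) u)%:E))%E.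
  by apply: eq_integral => u _; apply/esym/cvg_lim => //; exact: cvg_pt.
apply: cvg_monotone_convergence => //.
- by move=> n; apply/measurable_EFinP; exact: measurable_gain (harmonic_gt0 n).
- by move=> n u _; rewrite lee_fin gain_ge0// harmonic_gt0.
- move=> u _ a b ab; rewrite lee_fin ler_wpM2l ?sqdev_ge0//.
  have S0 := row_mass_gt0 i0 u pw.
  have hr n : 0 < harmonic n * rho i0 j0 u by rewrite mulr_gt0// harmonic_gt0.
  rewrite ler_pM2l// lef_pV2 ?posrE ?addr_gt0// lerD2l ler_pM2r//.
  by rewrite lef_pV2 ?posrE ?ltr0n// ler_nat ltnS.
Qed.

Lemma proper_weights_add p i0 j0 h : proper_weights p -> 0 <= h ->
  proper_weights (p + h *: delta_mx i0 j0).
Proof.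
move=> [p0 ps0] h0; have pE i j : p i j <= (p + h *: delta_mx i0 j0) i j.
  by rewrite !mxE lerDl mulr_ge0.
split=> [i j|i]; first exact: le_trans (p0 i j) (pE i j).
by apply: lt_le_trans (ps0 i) _; apply: ler_sum.
Qed.

(** [Phi] is a separate argument because the objective in the entries is identified with the
    abstract functional only at proper weights; positive increments stay among them. *)
Lemma mixture_functional_gradient (Phi : 'M[R]_(l, m) -> \bar R) p G :
  (forall q, proper_weights q -> Phi q = mixture_functional q) ->
  (0 < l)%N -> (0 < m)%N -> proper_weights p -> is_gradient Phi p G ->
  Phi p \is a fin_num /\ forall i j, (G i j)%:E = mean_sqdev p i j.
Proof.
move=> PhiE l0 m0 pw gG; rewrite PhiE//.
have Phi0 q : proper_weights q -> (0 <= mixture_functional q)%E.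
  move=> [q0 _]; apply: integral_ge0 => u _; rewrite lee_fin.
  apply: sumr_ge0 => i _; apply: sumr_ge0 => j _.
  by rewrite mulr_ge0 ?sqdev_ge0.
(* The filter of [is_gradient] is probed along the positive steps 1/(n+1), which are admissible even
   where [p i j] vanishes. *)
have pquot i j : ((@harmonic R n)^-1%:E * (mixture_functional
    (p + harmonic n *: delta_mx i j)%R - mixture_functional p))%E @[n --> \oo] --> (G i j)%:E.
  have E n : mixture_functional (p + harmonic n *: delta_mx i j) =
      Phi (p + harmonic n *: delta_mx i j).
    by rewrite PhiE//; apply: proper_weights_add => //; exact: harmonic_ge0.
  under eq_fun do rewrite E -(PhiE p pw).
  apply: cvg_comp (gG i j) => B.
  rewrite /within /= => -[e /= e0 H].
  have : \forall n \near \oo, `|@harmonic R n| < e.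
    by apply: cvgr0_norm_lt => //; exact: cvg_harmonic.
  apply: filterS => n /= hn; apply: H => /=.
  - by rewrite sub0r normrN.
  - by rewrite gt_eqF// harmonic_gt0.
  - by rewrite addr_ge0 ?harmonic_ge0//; case: pw.
(* Subtracting [+oo] gives [-oo] from any extended real, [+oo] included, so an infinite value at [p]
   would make every quotient [-oo], against the real limit. *)
have Pfin : mixture_functional p \is a fin_num.
  rewrite ge0_fin_numE ?Phi0// ltNge leye_eq; apply/negP => /eqP Poo.
  have := pquot (Ordinal l0) (Ordinal m0).
  rewrite Poo; under eq_fun do rewrite addeNy gt0_muleNy ?lte_fin ?invr_gt0 ?harmonic_gt0//.
  by move=> /cvg_lim => /(_ (@ereal_hausdorff _)); rewrite lim_cst.
split=> // i j.
have E n : ((@harmonic R n)^-1%:E * (mixture_functional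
    (p + harmonic n *: delta_mx i j)%R - mixture_functional p) =
   \int[mu]_u (gain p i j (harmonic n) u)%:E)%E.
  have hn := @harmonic_gt0 R n.
  rewrite mixture_functional_add// addeAC subee// add0e muleA -EFinM mulVf ?mul1e//.
  by rewrite gt_eqF.
have := pquot i j; under eq_fun do rewrite E.
move=> /(cvg_lim (@ereal_hausdorff R)) <-.
by apply/cvg_lim => //; exact: cvg_gain.
Qed.

End mixture_functional.

(** * The objective in the entries as a mixture functional *)

Section entries_objective.
Context {R : realType} {d : measure_display} {Omega : measurableType d}.
Variables (P : probability Omega R) (T0 T1 : R) (H1 H2 : R -> R).
Variables (D : R -> {RV P >-> R}) (g0 : R -> R).
Hypotheses (hT01 : T0 < T1) (hrap : standard_rap T0 T1 H1 H2 D g0).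
Context {l m : nat}.
Variables (x : 'I_l -> R) (y : 'I_m -> R).
Local Notation f0 := (std_f0 T0 T1 H1 H2).
Local Notation f1 := (std_f1 T0 T1 H1 H2).
Local Notation den := (H1 T1 * H2 T0 - H1 T0 * H2 T1).
Local Notation mu := (@lebesgue_measure R).
Local Notation I := (`]T0, T1[%classic : set R).
Local Notation dens := (arcade_density T0 T1 H1 H2 D).
Local Notation im := (info_mean T0 T1 H1 H2 D g0 x y).
Implicit Types p : 'M[R]_(l, m).

(** The value 1 outside the interval keeps the centred densities nondegenerate, hence positive, at
    every time. *)
Definition arcade_sd (t : R) : R :=
  if t \in `]T0, T1[ then Num.sqrt (f0 t * f1 t * den) else 1.

Definition arcade_shift (i : 'I_l) (j : 'I_m) : R -> R :=
  (fun t => g0 t * x i + f1 t * y j) \_ I.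

(* Translating by the mean of the arcade process, whose dependence on time is
   not known to be measurable, leaves only the centred densities. *)
Definition centred_density (i : 'I_l) (j : 'I_m)
    (u : measurableTypeR R * measurableTypeR R) : R :=
  normal_pdf 0 (arcade_sd u.1) (u.2 - arcade_shift i j u.1).

(** The mean squared error of the posterior mean at a fixed time, kept apart from the time weight
    because it is measurable in time for proper weights. *)
Definition entry_risk p (t : R) : \bar R :=
  (\sum_(i < l) \sum_(j < m) (p i j)%:E *
      \int[lebesgue_measure]_a
        ((y j - im p t (g0 t * x i + f1 t * y j + a) i) ^+ 2 * dens t a)%:E)%E.

Lemma arcade_sd_gt0 t : 0 < arcade_sd t.
Proof.
rewrite /arcade_sd; case: ifPn => // tI.
by rewrite sqrtr_gt0; exact: std_prod_gt0 hT01 hrap _ tI.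
Qed.

Lemma measurable_arcade_sd : measurable_fun setT arcade_sd.
Proof.
have -> : arcade_sd = (fun t => Num.sqrt (((f0 \* f1) \_ I) t * den
    + ((cst 1 : R -> R) \_ (~` I)) t)).
  apply/funext => t; rewrite /arcade_sd !patchE in_setC mem_setE.
  by case: ifPn => _ /=; rewrite ?addr0// mul0r add0r sqrtr1.
apply: measurableT_comp.
  by apply: continuous_measurable_fun; exact: sqrt_continuous.
apply: measurable_funD; last first.
  by apply/(measurable_restrictT (cst 1 : R -> R)) => //; exact: measurableC.
apply: measurable_funM => //.
apply/(measurable_restrictT (f0 \* f1)) => //; apply: measurable_funM.
- exact: measurable_restrict_continuous (continuous_std_f0 hrap).
- exact: measurable_restrict_continuous (continuous_std_f1 hrap).
Qed.

Lemma measurable_arcade_shift i j : measurable_fun setT (arcade_shift i j).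
Proof.
have [cg0 _ _ _] := rap_g hrap.
apply/(measurable_restrictT (fun t => g0 t * x i + f1 t * y j)) => //.
apply: measurable_funD; apply: measurable_funM => //.
- exact: measurable_restrict_continuous cg0.
- exact: measurable_restrict_continuous (continuous_std_f1 hrap).
Qed.

Lemma centred_density_gt0 i j u : 0 < centred_density i j u.
Proof.
rewrite /centred_density normal_pdfE ?gt_eqF ?arcade_sd_gt0//.
by rewrite mulr_gt0 ?expR_gt0// normal_peak_gt0// gt_eqF// arcade_sd_gt0.
Qed.

Lemma measurable_centred_density i j : measurable_fun setT (centred_density i j).
Proof.
have -> : centred_density i j = (fun u =>
   (Num.sqrt (arcade_sd u.1 ^+ 2 * pi *+ 2))^-1 *
     expR (- (u.2 - arcade_shift i j u.1) ^+ 2 * (arcade_sd u.1 ^+ 2 *+ 2)^-1)).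
  apply/funext => u; rewrite /centred_density normal_pdfE ?gt_eqF ?arcade_sd_gt0//.
  by rewrite /normal_peak /normal_fun subr0.
have msd : measurable_fun setT
    (fun u : measurableTypeR R * measurableTypeR R => arcade_sd u.1).
  exact: measurableT_comp measurable_arcade_sd measurable_fst.
have msd2 : measurable_fun setT
    (fun u : measurableTypeR R * measurableTypeR R => arcade_sd u.1 ^+ 2).
  exact: measurable_funX.
have mdiff : measurable_fun setT (fun u : measurableTypeR R * measurableTypeR R =>
    u.2 - arcade_shift i j u.1).
  apply: measurable_funB => //.
  exact: measurableT_comp (measurable_arcade_shift i j) measurable_fst.
apply: measurable_funM.
  apply: measurable_fun_inv_gt0; last first.
    by move=> u; rewrite sqrtr_gt0 pmulrn_lgt0// mulr_gt0 ?pi_gt0// exprn_gt0// arcade_sd_gt0.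
  apply: measurableT_comp.
    by apply: continuous_measurable_fun; exact: sqrt_continuous.
  under eq_fun do rewrite -mulr_natr -mulrA.
  exact: measurable_funM.
apply: measurableT_comp => //; apply: measurable_funM.
  by apply: measurableT_comp => //; exact: measurable_funX.
apply: measurable_fun_inv_gt0; last first.
  by move=> u; rewrite pmulrn_lgt0// exprn_gt0// arcade_sd_gt0.
by under eq_fun do rewrite -mulr_natr; exact: measurable_funM.
Qed.

Lemma arcade_densityE t a : t \in `]T0, T1[ ->
  dens t a = normal_pdf 0 (arcade_sd t) (a - fine ('E_P[arcade T0 T1 H1 H2 D t])%E).
Proof.
move=> tI; rewrite /arcade_density (variance_arcade hT01 hrap) ?subset_itv_oo_cc//=.
rewrite -normal_pdf_center; last by rewrite gt_eqF ?arcade_sd_gt0.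
by rewrite /arcade_sd tI.
Qed.

Lemma centred_densityE t i j z : t \in `]T0, T1[ ->
  centred_density i j (t, z) = dens t (fine ('E_P[arcade T0 T1 H1 H2 D t])%E +
     z - g0 t * x i - f1 t * y j).
Proof.
move=> tI; rewrite arcade_densityE// /centred_density /arcade_shift /=.
rewrite patchE mem_setE tI; congr normal_pdf; ring.
Qed.

Let pm p := posterior_mean y centred_density p.

Let risk_density p (u : measurableTypeR R * measurableTypeR R) : R :=
  \sum_i \sum_j p i j * (centred_density i j u * (y j - pm p i u) ^+ 2).

Let cd0 := centred_density_gt0.

Let risk_density_ge0 p u : proper_weights p -> 0 <= risk_density p u.
Proof.
move=> [p0 _]; apply: sumr_ge0 => i _; apply: sumr_ge0 => j _.
by rewrite mulr_ge0// mulr_ge0 ?sqr_ge0// ltW.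
Qed.

Let measurable_dev p i j : proper_weights p ->
  measurable_fun setT (fun u => centred_density i j u * (y j - pm p i u) ^+ 2).
Proof.
move=> pw; apply: measurable_funM; first exact: measurable_centred_density.
apply: measurable_funX; apply: measurable_funB => //.
apply: measurable_posterior_mean => //; exact: measurable_centred_density.
Qed.

Let measurable_risk_density p : proper_weights p ->
  measurable_fun setT (risk_density p).
Proof.
move=> pw; do 2! apply: measurable_sum => ?.
by apply: measurable_funM => //; exact: measurable_dev.
Qed.

(** The substitution [z = g0 t * x i + f1 t * y j + a - c], with [c] the mean of the arcade process,
    gives all entries of a row a common variable; the posterior mean is then one function of [z],
    not of [j]. *)
Let entry_riskE p t : proper_weights p -> t \in `]T0, T1[ ->
  entry_risk p t = (\int[mu]_z (risk_density p (t, z))%:E)%E.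
Proof.
move=> pw tI.
have p0 : forall i j, 0 <= p i j by case: pw.
have mt i j : measurable_fun setT
    (fun z : measurableTypeR R => centred_density i j (t, z) * (y j - pm p i (t, z)) ^+ 2).
  exact: measurableT_comp (measurable_dev i j pw) (measurable_pair1 t).
have t0 i j z : 0 <= centred_density i j (t, z) * (y j - pm p i (t, z)) ^+ 2.
  by rewrite mulr_ge0 ?sqr_ge0// ltW.
transitivity (\sum_i \sum_j (p i j)%:E * \int[mu]_z
    (centred_density i j (t, z) * (y j - pm p i (t, z)) ^+ 2)%:E)%E.
  apply: eq_bigr => i _; apply: eq_bigr => j _; congr (_ * _)%E.
  set c := fine ('E_P[arcade T0 T1 H1 H2 D t])%E.
  rewrite -(@ge0_integral_translation _ (g0 t * x i + f1 t * y j - c)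
    (fun z => (centred_density i j (t, z) * (y j - pm p i (t, z)) ^+ 2)%:E)).
  - apply: eq_integral => a _; congr EFin; rewrite mulrC; congr (_ * (_ - _) ^+ 2).
      by rewrite centred_densityE// -/c; congr arcade_density; ring.
    rewrite /info_mean /pm /posterior_mean /row_mass.
    by congr (_ / _); apply: eq_bigr => k _; rewrite centred_densityE// -/c;
      congr (_ * _); [congr (_ * _)|]; congr arcade_density; ring.
  - apply/measurable_EFinP. exact: mt.
  - by move=> z; rewrite /= lee_fin t0.
rewrite /risk_density.
under [RHS]eq_integral do rewrite -sumEFin.
rewrite ge0_integral_sum//; last 2 first.
- move=> i; under eq_fun do rewrite -sumEFin.
  by apply: emeasurable_sum => j; apply/measurable_EFinP; exact: measurable_funM.
- move=> i z _; rewrite lee_fin; apply: sumr_ge0 => j _.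
  by rewrite mulr_ge0 ?t0.
apply: eq_bigr => i _.
under [RHS]eq_integral do rewrite -sumEFin.
rewrite ge0_integral_sum//; last 2 first.
- by move=> j; apply/measurable_EFinP; exact: measurable_funM.
- by move=> j z _; rewrite lee_fin mulr_ge0 ?t0.
apply: eq_bigr => j _.
under [RHS]eq_integral do rewrite EFinM.
rewrite ge0_integralZl//.
- exact/measurable_EFinP.
- by move=> z _; rewrite lee_fin t0.
- by rewrite lee_fin.
Qed.

Lemma entry_risk_ge0 p t : proper_weights p -> t \in `]T0, T1[ ->
  (0 <= entry_risk p t)%E.
Proof.
move=> pw tI; rewrite entry_riskE//; apply: integral_ge0 => z _.
by rewrite lee_fin risk_density_ge0.
Qed.

Let measurable_risk p : proper_weights p ->
  measurable_fun setT (fun t => \int[mu]_z (risk_density p (t, z))%:E)%E.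
Proof.
move=> pw.
apply: (@measurable_fun_fubini_tonelli_F _ _ (measurableTypeR R) (measurableTypeR R) R
  mu (fun u => (risk_density p u)%:E)).
- by apply/measurable_EFinP; exact: measurable_risk_density.
- by move=> u; rewrite lee_fin risk_density_ge0.
Qed.

Lemma measurable_entry_risk p : proper_weights p -> measurable_fun I (entry_risk p).
Proof.
move=> pw; apply: eq_measurable_fun (measurable_funTS (measurable_risk pw)).
by move=> t; rewrite inE => tI; rewrite entry_riskE.
Qed.

Variable W : R -> R.
Hypotheses (mW : measurable_fun setT W) (W0 : forall t, 0 <= W t).
Hypotheses (W_off : forall t, t \notin `]T0, T1[ -> W t = 0).
Hypothesis W_weight : ae_eq mu I (weight T1 H1 H2) W.

Lemma objective_entries_version p : proper_weights p ->
  objective_entries T0 T1 H1 H2 D g0 x y p =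
  (\int[mu]_(t in I) ((W t)%:E * entry_risk p t))%E.
Proof.
move=> pw; rewrite /objective_entries -/(entry_risk p _).
apply: ge0_ae_eq_integral_nomeas => //.
- apply: emeasurable_funM; last exact: measurable_entry_risk.
  exact/measurable_EFinP/measurable_funTS.
- move=> t /= tI; rewrite mule_ge0 ?entry_risk_ge0// lee_fin.
  exact: weight_ge0 hT01 hrap _ tI.
- by move=> t /= tI; rewrite mule_ge0 ?entry_risk_ge0// lee_fin.
- have FF : Filter (almost_everywhere mu) by exact: ae_filter_ringOfSetsType.
  by apply: filterS W_weight => t /= H tI; rewrite H.
Qed.

(** Since [W] vanishes off the interval, Tonelli merges the time and space integrals into one over
    the plane, where the abstract functional is defined. *)
Lemma objective_entries_mixture p : proper_weights p ->
  objective_entries T0 T1 H1 H2 D g0 x y p =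
  mixture_functional (mu \x mu)%E y (fun u => W u.1) centred_density p.
Proof.
move=> pw; rewrite objective_entries_version// /mixture_functional.
have mWr : measurable_fun setT (fun u : measurableTypeR R * measurableTypeR R =>
    (W u.1 * risk_density p u)%:E).
  apply/measurable_EFinP; apply: measurable_funM; last exact: measurable_risk_density.
  exact: measurableT_comp mW measurable_fst.
transitivity (\int[mu \x mu]_u (W u.1 * risk_density p u)%:E)%E; last first.
  apply: eq_integral => u _; congr EFin; rewrite /risk_density mulr_sumr.
  apply: eq_bigr => i _; rewrite mulr_sumr; apply: eq_bigr => j _.
  by rewrite /sqdev -/(pm p); ring.
rewrite (fubini_tonelli1 _ mWr); last first.
  by move=> u; rewrite lee_fin mulr_ge0// risk_density_ge0.
rewrite integral_mkcond; apply: eq_integral => t _.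
rewrite patchE mem_setE /fubini_F /=; under eq_integral do rewrite EFinM.
rewrite ge0_integralZl//; last 3 first.
- apply/measurable_EFinP.
  exact: measurableT_comp (measurable_risk_density pw) (measurable_pair1 t).
- by move=> z _; rewrite lee_fin risk_density_ge0.
- by rewrite lee_fin.
case: ifPn => tI; first by rewrite entry_riskE.
by rewrite W_off// mul0e.
Qed.

End entries_objective.

(** * Couplings of empirical measures *)

Section grid.
Context {R : realType} {l m : nat}.
Variables (x : 'I_l -> R) (y : 'I_m -> R).
Hypotheses (hx : injective x) (hy : injective y).
Variable pi : probability (R * R)%type R.

Definition grid : set (R * R) := [set z | exists i j, z = (x i, y j)].

Let p := entries x y pi.

Let mpt i j : measurable ([set x i] `*` [set y j]).
Proof. exact: measurableX. Qed.

Lemma measurable_grid : measurable grid.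
Proof.
have -> : grid = \bigcup_i \bigcup_j ([set x i] `*` [set y j]).
  apply/seteqP; split => [z [i [j ->]]|z [i _ [j _ [/= z1 z2]]]].
    by exists i => //; exists j.
  by exists i, j; rewrite -z1 -z2; case: z {z1 z2}.
by apply: fin_bigcup_measurable => // i _; apply: fin_bigcup_measurable.
Qed.

Hypothesis pi_grid : pi (~` grid) = 0%E.

Lemma entries_ge0 i j : 0 <= p i j.
Proof. by rewrite mxE fine_ge0. Qed.

Let pE i j : pi ([set x i] `*` [set y j]) = (p i j)%:E.
Proof. by rewrite mxE fineK// fin_num_measure. Qed.

(** Almost surely [f] is the sum of its values times indicators of grid points; injectivity of [x]
    and [y] ensures that each grid point is counted once. *)
Lemma ge0_integral_grid (f : R * R -> \bar R) :
  measurable_fun setT f -> (forall z, (0 <= f z)%E) ->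
  (\int[pi]_z f z = \sum_i \sum_j (p i j)%:E * f (x i, y j))%E.
Proof.
move=> mf f0.
have t0 i j z : (0 <= f (x i, y j) * (\1_([set x i] `*` [set y j]) z)%:E)%E.
  by rewrite mule_ge0// lee_fin.
have mt i j : measurable_fun setT (fun z : R * R =>
    (f (x i, y j) * (\1_([set x i] `*` [set y j]) z)%:E)%E).
  by apply: emeasurable_funM => //; apply/measurable_EFinP; exact: measurable_indic.
transitivity (\int[pi]_z (\sum_i \sum_j
    f (x i, y j) * (\1_([set x i] `*` [set y j]) z)%:E))%E.
  apply: ge0_ae_eq_integral => //.
  - by apply: emeasurable_sum => i; exact: emeasurable_sum.
  - by move=> z _; apply: sume_ge0 => i _; exact: sume_ge0.
  - exists (~` grid); split => //; first by apply: measurableC; exact: measurable_grid.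
    move=> z /= H [i [j zE]]; apply: H => _; rewrite zE.
    rewrite (bigD1 i)//= (bigD1 j)//= !big1 ?adde0.
    + by rewrite indicE mem_set// mule1.
    + move=> k ki; apply: big1 => n _; rewrite indicE memNset ?mule0// => -[/= /hx].
      by move=> ik; rewrite ik eqxx in ki.
    + move=> n nj; rewrite indicE memNset ?mule0// => -[_ /= /hy].
      by move=> jn; rewrite jn eqxx in nj.
rewrite ge0_integral_sum//; last 2 first.
- by move=> i; exact: emeasurable_sum.
- by move=> i z _; exact: sume_ge0.
apply: eq_bigr => i _; rewrite ge0_integral_sum//.
apply: eq_bigr => j _; rewrite ge0_integralZl//; last first.
  by apply/measurable_EFinP; exact: measurable_indic.
by rewrite integral_indic// setIT /= muleC; congr (_ * _)%E; exact: pE.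
Qed.

Lemma integrable_grid (g : R * R -> R) : measurable_fun setT g ->
  pi.-integrable setT (EFin \o g).
Proof.
move=> mg; apply/integrableP; split; first exact/measurable_EFinP.
rewrite ge0_integral_grid//; last exact/measurableT_comp/measurable_EFinP.
under eq_bigr do under eq_bigr do rewrite /= -EFinM.
by under eq_bigr do rewrite sumEFin; rewrite sumEFin ltry.
Qed.

Lemma integral_grid (g : R * R -> R) : measurable_fun setT g ->
  (\int[pi]_z (g z)%:E = (\sum_i \sum_j p i j * g (x i, y j))%:E)%E.
Proof.
move=> mg; have mEg : measurable_fun setT (EFin \o g) by exact/measurable_EFinP.
rewrite integralE !ge0_integral_grid//; last 2 first.
- exact: measurable_funeneg.
- exact: measurable_funepos.
under eq_bigr do under eq_bigr do rewrite funeposE /= -EFin_max -EFinM.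
under [X in (_ - X)%E]eq_bigr do
  under eq_bigr do rewrite funenegE /= -EFin_max -EFinM.
under eq_bigr do rewrite sumEFin.
under [X in (_ - X)%E]eq_bigr do rewrite sumEFin.
rewrite !sumEFin -EFinB; congr EFin; rewrite -sumrB; apply: eq_bigr => i _.
rewrite -sumrB; apply: eq_bigr => j _; rewrite -mulrBr; congr (_ * _).
by rewrite /Order.max; case: ltP => ?; case: ltP => ?; lra.
Qed.

Lemma measure_grid A : measurable A ->
  pi A = (\sum_i \sum_j p i j * \1_A (x i, y j))%:E.
Proof.
move=> mA; rewrite -(@integral_grid (\1_A)); last exact: measurable_indic.
by rewrite integral_indic// setIT.
Qed.

End grid.

Section discrete_measure.
Local Open Scope ereal_scope.
Context {R : realType} {d : measure_display} {T : measurableType d} {n : nat}.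
Variables (w : 'I_n -> {nonneg R}) (a : 'I_n -> T).

Let summand (k : nat) : {measure set T -> \bar R} :=
  if insub k is Some i then mscale (w i) (dirac (a i)) else mzero.

Let discrete_msum : {measure set T -> \bar R} := msum summand n.

Lemma discrete_probability : (\sum_i (w i)%:num = 1)%R ->
  exists pi : probability T R,
    forall A, pi A = \sum_i (w i)%:num%:E * \d_(a i) A.
Proof.
move=> w1.
have E A : discrete_msum A = \sum_i (w i)%:num%:E * \d_(a i) A.
  by rewrite /discrete_msum/= /msum; apply: eq_bigr => i _; rewrite /summand valK.
have pT : discrete_msum setT = 1.
  rewrite E; under eq_bigr do rewrite diracT mule1.
  by rewrite sumEFin w1.
pose mix := Measure_isProbability.Build _ _ _ discrete_msum pT.
pose pi : probability T R := HB.pack (discrete_msum : set T -> \bar R) discrete_msum mix.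
by exists pi => A; rewrite -E.
Qed.

End discrete_measure.

(** * Martingale couplings as a polytope of matrices *)

Section coupling_polytope.
Context {R : realType} {l m : nat}.
Variables (x : 'I_l -> R) (y : 'I_m -> R).
Hypotheses (l0 : (0 < l)%N) (m0 : (0 < m)%N).
Hypotheses (hx : injective x) (hy : injective y).
Implicit Types p : 'M[R]_(l, m).

(** The last condition is the martingale property at [x i] multiplied by the mass of that atom,
    which makes it linear in [p]. *)
Definition coupling_polytope p :=
  [/\ forall i j, 0 <= p i j,
      forall i, \sum_j p i j = l%:R^-1,
      forall j, \sum_i p i j = m%:R^-1 &
      forall i, \sum_j p i j * y j = l%:R^-1 * x i].

Lemma empiricalE n (a : 'I_n -> R) A :
  empirical a A = (n%:R^-1 * \sum_i \1_A (a i))%:E.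
Proof.
by rewrite /empirical EFinM -sumEFin.
Qed.

Section coupling.
Variable pi : probability (R * R)%type R.
Hypothesis hpi : martingale_coupling (empirical x) (empirical y) pi.

(** Each marginal charges only the range of its atoms, so the complement of the grid lies in the
    union of two null strips. *)
Lemma coupling_grid : pi (~` grid x y) = 0%E.
Proof.
have [mX mY _] := hpi.
have mr n (a : 'I_n -> R) : measurable (range a).
  have -> : range a = \bigcup_i [set a i].
    by apply/seteqP; split => [_ [i _ <-]|z [i _ ->]]; exists i.
  by apply: fin_bigcup_measurable.
have e0 n (a : 'I_n -> R) : empirical a (~` range a) = 0%E.
  rewrite empiricalE big1 ?mulr0// => i _.
  by rewrite indicE memNset// => H; apply: H; exists i.
have X0 := mX _ (measurableC (mr _ x)); rewrite e0 in X0.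
have Y0 := mY _ (measurableC (mr _ y)); rewrite e0 in Y0.
have mXc : measurable ((~` range x) `*` [set: R]) by apply: measurableX => //; exact: measurableC.
have mYc : measurable ([set: R] `*` (~` range y)) by apply: measurableX => //; exact: measurableC.
have U0 : pi (((~` range x) `*` [set: R]) `|` ([set: R] `*` (~` range y))) = 0%E.
  by rewrite measureU0.
apply: (subset_measure0 _ _ _ U0).
- by apply: measurableC; exact: measurable_grid.
- exact: measurableU.
- move=> [a b] /= H.
  have [[i _ ai]|] := pselect (range x a); last by left.
  have [[j _ bj]|] := pselect (range y b); last by right.
  by exfalso; apply: H; exists i, j; rewrite ai bj.
Qed.

Let p := entries x y pi.

Lemma coupling_row i : \sum_j p i j = l%:R^-1.
Proof.
have [mX _ _] := hpi.
have := mX [set x i] (measurable_set1 _).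
rewrite (measure_grid hx hy coupling_grid); last exact: measurableX.
rewrite empiricalE => -[].
rewrite (bigD1 i)//= [X in _ + X]big1 ?addr0; last first.
  move=> k ki; apply: big1 => j _; rewrite indicE memNset ?mulr0// => -[/= /hx].
  by move=> ik; rewrite ik eqxx in ki.
rewrite [X in _ = _ * X](bigD1 i)//= [X in _ = _ * (_ + X)]big1 ?addr0; last first.
  move=> k ki; rewrite indicE memNset// => /= /hx ik.
  by rewrite ik eqxx in ki.
rewrite [X in _ = _ * X]indicE mem_set// mulr1 => <-.
by apply: eq_bigr => j _; rewrite indicE mem_set ?mulr1.
Qed.

Lemma coupling_col j : \sum_i p i j = m%:R^-1.
Proof.
have [_ mY _] := hpi.
have := mY [set y j] (measurable_set1 _).
rewrite (measure_grid hx hy coupling_grid); last exact: measurableX.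
rewrite empiricalE => -[].
rewrite [X in _ = _ * X](bigD1 j)//= [X in _ = _ * (_ + X)]big1 ?addr0; last first.
  move=> k ki; rewrite indicE memNset// => /= /hy ik.
  by rewrite ik eqxx in ki.
rewrite [X in _ = _ * X]indicE mem_set// mulr1 => <-.
apply: eq_bigr => i _.
rewrite (bigD1 j)//= big1 ?addr0; last first.
  move=> k kj; rewrite indicE memNset ?mulr0// => -[_ /= /hy].
  by move=> ik; rewrite ik eqxx in kj.
by rewrite indicE mem_set ?mulr1.
Qed.

(** The conditional expectation is tested on the strip over [x i], which belongs to the
    sigma-algebra of the first coordinate. *)
Lemma coupling_martingale i : \sum_j p i j * y j = l%:R^-1 * x i.
Proof.
have [_ _ [_ _ _ hM]] := hpi.
have mA : measurable ([set x i] `*` [set: R]) by exact: measurableX.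
have /hM : sigma_of (fst : R * R -> R) ([set x i] `*` [set: R]).
  exists [set x i]; first exact: measurable_set1.
  by apply/seteqP; split => [z [_ ?]|z [? _]].
have restr (f : R * R -> R) : measurable_fun setT f ->
    (\int[pi]_(z in [set x i] `*` [set: R]) (f z)%:E =
     (\sum_j p i j * f (x i, y j))%:E)%E.
  move=> mf; rewrite integral_mkcond.
  transitivity (\int[pi]_z (f z * \1_([set x i] `*` [set: R]) z)%:E)%E.
    apply: eq_integral => z _; rewrite patchE indicE.
    by case: ifPn => _; rewrite ?mulr1 ?mulr0.
  rewrite (integral_grid hx hy coupling_grid); last first.
    by apply: measurable_funM => //; exact: measurable_indic.
  congr EFin; rewrite (bigD1 i)//= [X in _ + X]big1 ?addr0; last first.
    move=> k ki; apply: big1 => j _; rewrite indicE memNset ?mulr0// => -[/= /hx].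
    by move=> ik; rewrite ik eqxx in ki.
  by apply: eq_bigr => j _; rewrite indicE mem_set ?mulr1.
rewrite !restr// => -[/= <-].
by rewrite -mulr_suml coupling_row.
Qed.

Lemma coupling_in_polytope : coupling_polytope p.
Proof.
split; [|exact: coupling_row|exact: coupling_col|exact: coupling_martingale].
by move=> i j; exact: entries_ge0.
Qed.

End coupling.

(** The coupling puts mass [p i j] at [(x i, y j)]. This direction is needed to realise the average
    of the iterates by an actual coupling. *)
Lemma polytope_coupling p : coupling_polytope p ->
  exists pi : probability (R * R)%type R,
    martingale_coupling (empirical x) (empirical y) pi /\ entries x y pi = p.
Proof.
move=> [p0 prow pcol pmart].
have sum_enum (V : nmodType) (F : 'I_l * 'I_m -> V) :
    \sum_(k < #|{: 'I_l * 'I_m}|) F (enum_val k) = \sum_i \sum_j F (i, j).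
  by rewrite -(big_enum_val F) pair_big; apply: eq_big => [[]|[]].
pose w (k : 'I_#|{: 'I_l * 'I_m}|) : {nonneg R} :=
  NngNum (p0 (enum_val k).1 (enum_val k).2).
have w1 : \sum_k (w k)%:num = 1.
  rewrite /= (sum_enum _ (fun ij => p ij.1 ij.2))/=.
  under eq_bigr do rewrite prow.
  by rewrite sumr_const card_ord -[LHS]mulr_natl divff// pnatr_eq0 -lt0n.
have [pi piE] := @discrete_probability R _ (R * R)%type _ w
  (fun k => (x (enum_val k).1, y (enum_val k).2)) w1.
have {piE}piE A : pi A = (\sum_i \sum_j p i j * \1_A (x i, y j))%:E.
  rewrite piE (sum_enum _ (fun ij => (p ij.1 ij.2)%:E * \d_(x ij.1, y ij.2) A)%E)/=.
  rewrite -sumEFin; apply: eq_bigr => i _; rewrite -sumEFin.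
  by apply: eq_bigr => j _; rewrite diracE indicE EFinM.
have pi_grid : pi (~` grid x y) = 0%E.
  rewrite piE big1// => i _; apply: big1 => j _.
  by rewrite indicE memNset ?mulr0// => H; apply: H; exists i, j.
have pi_p : entries x y pi = p.
  apply/matrixP => i j; rewrite mxE piE/= (bigD1 i)//= (bigD1 j)//= !big1 ?addr0.
  - by rewrite indicE mem_set ?mulr1.
  - move=> k ki; apply: big1 => n _; rewrite indicE memNset ?mulr0// => -[/= /hx].
    by move=> ik; rewrite ik eqxx in ki.
  - move=> n nj; rewrite indicE memNset ?mulr0// => -[_ /= /hy].
    by move=> jn; rewrite jn eqxx in nj.
exists pi; split => //; split.
- move=> A mA; rewrite piE empiricalE; congr EFin; rewrite mulr_sumr.
  apply: eq_bigr => i _; rewrite -(prow i) mulr_suml; apply: eq_bigr => j _.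
  congr (_ * _); rewrite !indicE; congr (_%:R); congr nat_of_bool.
  by apply/idP/idP; rewrite !inE => // -[].
- move=> B mB; rewrite piE empiricalE exchange_big/=; congr EFin; rewrite mulr_sumr.
  apply: eq_bigr => j _; rewrite -(pcol j) mulr_suml; apply: eq_bigr => i _.
  congr (_ * _); rewrite !indicE; congr (_%:R); congr nat_of_bool.
  by apply/idP/idP; rewrite !inE => // -[].
- split.
  + exact: (integrable_grid hx hy pi_grid measurable_snd).
  + exact: (integrable_grid hx hy pi_grid measurable_fst).
  + by move=> B mB; exists B => //; rewrite setTI.
  (* Events of the first coordinate are unions of strips, so both integrals split over the rows,
     where the linear martingale condition applies. *)
  + move=> _ [B mB <-]; rewrite setTI.
    have restr (f : R * R -> R) : measurable_fun setT f ->
        (\int[pi]_(z in fst @^-1` B) (f z)%:E =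
         (\sum_i \sum_j p i j * (f (x i, y j) * \1_B (x i)))%:E)%E.
      move=> mf; rewrite integral_mkcond.
      transitivity (\int[pi]_z (f z * \1_B z.1)%:E)%E.
        apply: eq_integral => z _; rewrite patchE indicE.
        have -> : (z \in fst @^-1` B) = (z.1 \in B).
          by apply/idP/idP; rewrite !inE.
        by case: ifPn => _; rewrite ?mulr1 ?mulr0.
      rewrite (integral_grid hx hy pi_grid) ?pi_p//.
      apply: measurable_funM => //.
      exact: measurableT_comp (measurable_indic mB) measurable_fst.
    rewrite !restr//; congr EFin; apply: eq_bigr => i _.
    under eq_bigr do rewrite mulrA; under [RHS]eq_bigr do rewrite mulrA.
    by rewrite -!mulr_suml /= prow pmart.
Qed.

Lemma coupling_entriesE : coupling_entries x y = [set p | coupling_polytope p].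
Proof.
apply/seteqP; split => [_ [pi hpi <-]|p /polytope_coupling[pi [hpi <-]]].
  exact: coupling_in_polytope.
by exists pi.
Qed.

End coupling_polytope.

(** * The conditional expectation of the terminal value *)

Section cond_exp_uniqueness.
Context {R : realType} {d d' : measure_display} {T : measurableType d}
  {T' : measurableType d'}.
Variables (mu : {measure set T -> \bar R}) (h : T -> T').
Hypothesis mh : measurable_fun setT h.

(** On the space restricted to the sigma-algebra of [h], both versions are measurable and have equal
    integrals over every measurable set, hence agree almost everywhere. *)
Lemma cond_exp_unique (X Y Y' : T -> R) :
  is_cond_exp mu (sigma_of h) X Y -> is_cond_exp mu (sigma_of h) X Y' ->
  ae_eq mu setT (EFin \o Y) (EFin \o Y').
Proof.
move=> [_ iY mY hY] [_ iY' mY' hY'].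
pose S : measurableType _ := g_sigma_algebra_preimageType h.
(* The identity, seen as a map onto the same set with the smaller sigma-algebra; pushing forward
   along it restricts the measure. *)
pose j : T -> S := id.
have mj : measurable_fun setT j.
  by move=> _ A [B mB <-]; rewrite setTI setTI; rewrite -[X in measurable X]setTI; exact: mh.
have mS (Z : T -> R) : measurable_wrt (sigma_of h) Z -> measurable_fun setT (EFin \o (Z : S -> R)).
  by move=> mZ; apply/measurable_EFinP => _ B mB; rewrite setTI; exact: mZ.
have push (Z : T -> R) E : measurable_wrt (sigma_of h) Z ->
    mu.-integrable setT (EFin \o Z) -> measurable E ->
    (\int[pushforward mu j]_(w in E) (Z w)%:E = \int[mu]_(w in E) (Z w)%:E)%E.
  move=> mZ iZ mE; rewrite (integral_pushforward mj (mS _ mZ) _ mE)//.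
  apply: integrableS iZ => //.
  by rewrite -[X in measurable X]setTI; exact: mj.
pose nu : {measure set S -> \bar R} :=
  measure_function_pushforward__canonical__measure_function_Measure mu mj.
have [N [mN N0 subN]] : ae_eq nu setT (EFin \o (Y : S -> R)) (EFin \o Y').
  apply: integral_ae_eq => //.
  - by apply: (integrable_pushforward mj (mS _ mY)) => //; rewrite preimage_setT.
  - exact: mS.
  - by move=> E _ mE; rewrite !push// hY// hY'.
exists N; split => //.
by rewrite -[X in measurable X]setTI; exact: (mj measurableT N mN).
Qed.

End cond_exp_uniqueness.

Section information_mean.
Context {R : realType} {d : measure_display} {Omega : measurableType d}.
Variables (P : probability Omega R) (T0 T1 : R) (H1 H2 : R -> R).
Variables (D : R -> {RV P >-> R}) (g0 : R -> R).
Hypotheses (hT01 : T0 < T1) (hrap : standard_rap T0 T1 H1 H2 D g0).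
Context {l m : nat}.
Variables (x : 'I_l -> R) (y : 'I_m -> R).
Hypotheses (hx : injective x) (hy : injective y).
Variable pi : probability (R * R)%type R.
Hypothesis pi_grid : pi (~` grid x y) = 0%E.
Local Notation p := (entries x y pi).
Hypothesis pw : proper_weights p.
Local Notation f0 := (std_f0 T0 T1 H1 H2).
Local Notation f1 := (std_f1 T0 T1 H1 H2).
Local Notation mu := (@lebesgue_measure R).
Local Notation A := (arcade T0 T1 H1 H2 D).
Local Notation rp := (rap T0 T1 H1 H2 D g0).
Local Notation dens := (arcade_density T0 T1 H1 H2 D).
Local Notation im := (info_mean T0 T1 H1 H2 D g0 x y p).
Local Notation Q := (P \x pi)%E.

Variable t : R.
Hypothesis tI : t \in `]T0, T1[.

Let measurable_A : measurable_fun setT (A t). Proof. exact: measurable_arcade. Qed.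

Let shift i j : R := g0 t * x i + f1 t * y j.

Lemma arcade_density_gt0 a : 0 < dens t a.
Proof.
rewrite (arcade_densityE hT01 hrap)//.
have s0 := arcade_sd_gt0 hT01 hrap t.
by rewrite normal_pdfE ?gt_eqF// mulr_gt0 ?expR_gt0// normal_peak_gt0// gt_eqF.
Qed.

Lemma measurable_arcade_density : measurable_fun setT (dens t).
Proof. exact: measurable_normal_pdf. Qed.

Let measurable_arcade_pair :
  measurable_fun setT (fun w : Omega * (R * R) => (A t w.1, w.2)).
Proof.
apply/measurable_fun_pairP; split; last exact: measurable_snd.
exact: measurableT_comp measurable_A measurable_fst.
Qed.

(** By independence the joint law of arcade value and endpoints is a product of a Gaussian law and a
    law carried by the grid. *)
Lemma ge0_integral_sample (f : R * (R * R) -> \bar R) :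
  measurable_fun setT f -> (forall u, (0 <= f u)%E) ->
  (\int[Q]_w f (A t w.1, w.2) = \sum_i \sum_j (p i j)%:E *
     \int[mu]_a (f (a, (x i, y j)) * (dens t a)%:E))%E.
Proof.
move=> mf f0'.
have p0 : forall i j, 0 <= p i j by case: pw.
have mfA : measurable_fun setT (fun w : Omega * (R * R) => f (A t w.1, w.2)).
  exact: measurableT_comp mf measurable_arcade_pair.
rewrite (fubini_tonelli1 _ mfA); last by move=> w; exact: f0'.
have mfij i j : measurable_fun setT (fun a : R => f (a, (x i, y j))).
  exact: measurableT_comp mf (measurable_pair2 (x i, y j)).
transitivity (\int[P]_w (\sum_i \sum_j (p i j)%:E * f (A t w, (x i, y j))))%E.
  apply: eq_integral => w _; rewrite /fubini_F /=.
  rewrite (@ge0_integral_grid _ _ _ _ _ hx hy _ pi_grid (fun z => f (A t w, z)))//.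
  exact: measurableT_comp mf (measurable_pair1 (A t w)).
have mfA' i j : measurable_fun setT (fun w => f (A t w, (x i, y j))).
  exact: measurableT_comp (mfij i j) measurable_A.
have t0 i j w : (0 <= (p i j)%:E * f (A t w, (x i, y j)))%E.
  by rewrite mule_ge0 ?lee_fin.
have mt i j : measurable_fun setT (fun w => ((p i j)%:E * f (A t w, (x i, y j)))%E).
  by apply: emeasurable_funM.
rewrite ge0_integral_sum//; last 2 first.
- by move=> i; exact: emeasurable_sum.
- by move=> i w _; exact: sume_ge0.
apply: eq_bigr => i _; rewrite ge0_integral_sum//; apply: eq_bigr => j _.
rewrite ge0_integralZl ?lee_fin//; congr (_ * _)%E.
rewrite (gaussian_density measurable_A _ _ (mfij i j))//.
- by apply: (gaussian_arcade hT01 hrap); exact: (subset_itv_oo_cc tI).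
- exact: (rap_nondegenerate hrap tI).
Qed.

(* Nonnegativity is only required on the support of the coupling. *)
Lemma integral_sample (g : R * (R * R) -> R) : measurable_fun setT g ->
  (forall a i j, 0 <= g (a, (x i, y j))) ->
  (\int[Q]_w (g (A t w.1, w.2))%:E = \sum_i \sum_j (p i j)%:E *
     \int[mu]_a (g (a, (x i, y j)) * dens t a)%:E)%E.
Proof.
move=> mg g0'; have mEg : measurable_fun setT (EFin \o g) by exact/measurable_EFinP.
rewrite integralE.
have -> : (\int[Q]_w ((fun w => (g (A t w.1, w.2))%:E)^\- w) = 0)%E.
  transitivity (\int[Q]_w ((EFin \o g)^\- (A t w.1, w.2)))%E.
    by apply: eq_integral => w _; rewrite !funenegE.
  rewrite (@ge0_integral_sample ((EFin \o g)^\-)%E); last 2 first.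
  - exact: measurable_funeneg.
  - by move=> u; exact: funeneg_ge0.
  apply: big1 => i _; apply: big1 => j _; rewrite integral0_eq ?mule0// => a _.
  by rewrite funenegE /= max_r ?mul0e// lee_fin oppr_le0.
rewrite sube0.
transitivity (\int[Q]_w ((EFin \o g)^\+ (A t w.1, w.2)))%E.
  by apply: eq_integral => w _; rewrite !funeposE.
rewrite (@ge0_integral_sample ((EFin \o g)^\+)%E); last 2 first.
- exact: measurable_funepos.
- by move=> u; exact: funepos_ge0.
apply: eq_bigr => i _; apply: eq_bigr => j _; congr (_ * _)%E.
by apply: eq_integral => a _; rewrite funeposE /= max_l// lee_fin.
Qed.

Let rho (i : 'I_l) (j : 'I_m) (z : measurableTypeR R) : R :=
  dens t (z - g0 t * x i - f1 t * y j).

Let rho_gt0 i j z : 0 < rho i j z. Proof. exact: arcade_density_gt0. Qed.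

Let measurable_rho i j : measurable_fun setT (rho i j).
Proof.
apply: measurableT_comp; first exact: measurable_arcade_density.
by apply: measurable_funB => //; exact: measurable_funB.
Qed.

Let imE i z : im t z i = posterior_mean y rho p i z. Proof. by []. Qed.

Lemma measurable_info_mean i : measurable_fun setT (fun z => im t z i).
Proof. exact: (measurable_posterior_mean y measurable_rho rho_gt0 i pw). Qed.

Let K := \sum_j `|y j|.

Let yK j : `|y j| <= K.
Proof. by rewrite /K (bigD1 j)//= lerDl; apply: sumr_ge0. Qed.

(** The posterior mean is a weighted average of the [y j]. The bound gives integrability and
    supplies the constant that makes the integrands below nonnegative. *)
Lemma info_mean_bounded i z : `|im t z i| <= K.
Proof.
rewrite imE /posterior_mean; have S0 := row_mass_gt0 rho_gt0 i z pw.
rewrite normrM normfV (gtr0_norm S0) ler_pdivrMr// /row_mass mulr_sumr.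
apply: (le_trans (ler_norm_sum _ _ _)); apply: ler_sum => j _.
have r0 : 0 <= rho i j z * p i j by rewrite mulr_ge0 ?(ltW (rho_gt0 _ _ _))//; case: pw.
by rewrite -mulrA normrM (ger0_norm r0) ler_wpM2r.
Qed.

(** The indicators select the row of the observed [X0], which makes this a function of [X0] and the
    signal on the whole sample space; it is 0 off the atoms. *)
Definition info_mean_version (w : Omega * (R * R)) : R :=
  \sum_i (X0 w == x i)%:R * im t (rp t w) i.

Let selected (zr : R * R) : R := \sum_i \1_[set x i] zr.1 * im t zr.2 i.

Let info_mean_versionE w : info_mean_version w = selected (X0 w, rp t w).
Proof.
apply: eq_bigr => i _; rewrite indicE; congr (_%:R * _); congr nat_of_bool.
by apply/eqP/idP; rewrite inE.
Qed.

Let measurable_selected : measurable_fun setT selected.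
Proof.
apply: measurable_sum => i; apply: measurable_funM.
  exact: measurableT_comp (measurable_indic (measurable_set1 _)) measurable_fst.
exact: measurableT_comp (measurable_info_mean i) measurable_snd.
Qed.

Let selected_grid i r : selected (x i, r) = im t r i.
Proof.
rewrite /selected (bigD1 i)//= big1 ?addr0.
  by rewrite indicE mem_set// mul1r.
move=> k ki; rewrite indicE memNset ?mul0r// => /= /hx ik.
by rewrite ik eqxx in ki.
Qed.

(* the pair [(X_0, I_t)] as a function of [(A_t, (X_0, X_1))] *)
Let signal (u : R * (R * R)) : R * R := (u.2.1, g0 t * u.2.1 + f1 t * u.2.2 + u.1).

Let measurable_signal : measurable_fun setT signal.
Proof.
have m21 : measurable_fun setT (fun u : R * (R * R) => u.2.1).
  exact: measurableT_comp measurable_fst measurable_snd.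
have m22 : measurable_fun setT (fun u : R * (R * R) => u.2.2).
  exact: measurableT_comp measurable_snd measurable_snd.
apply/measurable_fun_pairP; split => //.
by apply: measurable_funD => //; apply: measurable_funD; apply: measurable_funM.
Qed.

Lemma measurable_X0_rap :
  measurable_fun setT (fun w : Omega * (R * R) => (X0 w, rp t w)).
Proof. exact: measurableT_comp measurable_signal measurable_arcade_pair. Qed.

Let selected_bound z : `|selected z| <= l%:R * K.
Proof.
apply: (le_trans (ler_norm_sum _ _ _)).
rewrite -[X in X%:R]card_ord mulr_natl -sumr_const; apply: ler_sum => i _.
rewrite normrM indicE; case: (_ \in _); rewrite ?normr1 ?mul1r ?normr0 ?mul0r.
  exact: info_mean_bounded.
by apply: le_trans (info_mean_bounded i 0).
Qed.


(** Translating each term by its own shift expresses the whole row through the observed signal value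
    [z], and the likelihoods [rho i j z] appear. *)
Let sum_integral_translation i (h : 'I_m -> R -> R) :
  (forall j, measurable_fun setT (h j)) -> (forall j z, 0 <= h j z) ->
  (\sum_j (p i j)%:E * \int[mu]_a (h j (shift i j + a) * dens t a)%:E =
   \int[mu]_z (\sum_j p i j * (h j z * rho i j z))%:E)%E.
Proof.
move=> mh h0; have p0 : forall i j, 0 <= p i j by case: pw.
have mhr j : measurable_fun setT (fun z : measurableTypeR R => h j z * rho i j z).
  by apply: measurable_funM; [exact: mh|exact: measurable_rho].
have hr0 j z : 0 <= h j z * rho i j z by rewrite mulr_ge0// ltW.
under [RHS]eq_integral do rewrite -sumEFin.
rewrite ge0_integral_sum//; last 2 first.
- by move=> j; apply/measurable_EFinP; exact: measurable_funM.
- by move=> j z _; rewrite lee_fin mulr_ge0 ?hr0.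
apply: eq_bigr => j _; under [RHS]eq_integral do rewrite EFinM.
have mhrE : measurable_fun setT (fun z : measurableTypeR R => (h j z * rho i j z)%:E).
  by apply/measurable_EFinP; exact: mhr.
have -> : (\int[mu]_a (h j (shift i j + a) * dens t a)%:E =
    \int[mu]_z (h j z * rho i j z)%:E)%E.
  rewrite -(ge0_integral_translation (shift i j) mhrE).
    apply: eq_integral => a _; congr (_ * _)%:E.
    by rewrite /rho /shift; congr arcade_density; ring.
  by move=> z; rewrite lee_fin hr0.
rewrite ge0_integralZl; first by [].
- exact: measurableT.
- exact: mhrE.
- by move=> z _; rewrite lee_fin hr0.
- by rewrite lee_fin.
Qed.

Let G := sigma_of (fun w : Omega * (R * R) => (X0 w, rp t w)).

(** Bayes' formula: for a fixed row and signal value, the likelihood-weighted sums of the posterior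
    mean and of the [y j] coincide by the definition of the former. *)
Lemma info_mean_version_cond_exp : Q.-integrable setT (EFin \o (@X1 R d Omega)) ->
  is_cond_exp Q G (@X1 R d Omega) info_mean_version.
Proof.
move=> iX; have mM : measurable_fun setT info_mean_version.
  rewrite (funext info_mean_versionE).
  exact: measurableT_comp measurable_selected measurable_X0_rap.
have iM : Q.-integrable setT (EFin \o info_mean_version).
  apply: (@measurable_bounded_integrable _ _ _ Q info_mean_version setT) => //.
  - by apply: le_lt_trans (probability_le1 _ _) _ => //; rewrite ltry.
  - exists (l%:R * K); split; first exact: num_real.
    move=> M lM w _ /=; rewrite info_mean_versionE.
    by apply: (le_trans (selected_bound _)); exact: ltW.
split => //.
  move=> B mB; exists (selected @^-1` B).
    by rewrite -[X in measurable X]setTI; exact: measurable_selected.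
  by rewrite setTI; apply/seteqP; split => w /=; rewrite info_mean_versionE.
move=> _ [B mB <-]; rewrite setTI; set E := _ @^-1` B.
have mE : measurable E.
  by rewrite -[X in measurable X]setTI; exact: measurable_X0_rap.
have iK : Q.-integrable E (EFin \o cst K).
  apply: (integrableS measurableT) => //.
  apply: (@measurable_bounded_integrable _ _ _ Q (cst K) setT) => //.
  - by apply: le_lt_trans (probability_le1 _ _) _ => //; rewrite ltry.
  - by exists K; split; [exact: num_real|move=> N KN w _ /=; rewrite ger0_norm ?(ltW KN)//; exact: sumr_ge0].
have iE f : Q.-integrable setT (EFin \o f) -> Q.-integrable E (EFin \o f).
  exact: integrableS.
(* Adding [K] makes [X1] and the posterior mean nonnegative on the support of the coupling, so
   nonnegative integration applies; the integral of [K] is subtracted on both sides. *)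
have sub f : Q.-integrable setT (EFin \o f) ->
    (\int[Q]_(w in E) (f w)%:E =
     \int[Q]_(w in E) (f w + K)%:E - \int[Q]_(w in E) (cst K w)%:E)%E.
  move=> iF; rewrite -integralB_EFin//.
    by apply: eq_integral => w _; rewrite -EFinB addrK.
  have := integrableD mE (iE _ iF) iK.
  by apply: eq_integrable => // w _.
rewrite (sub _ iX) (sub _ iM); congr (_ - _)%E.
have patch f (g : R * (R * R) -> R) : (forall w, f w = g (A t w.1, w.2)) ->
    (\int[Q]_(w in E) (f w)%:E =
     \int[Q]_w (\1_B (signal (A t w.1, w.2)) * g (A t w.1, w.2))%:E)%E.
  move=> fg; rewrite integral_mkcond; apply: eq_integral => w _.
  rewrite patchE indicE fg.
  have -> : (w \in E) = (signal (A t w.1, w.2) \in B) by apply/idP/idP; rewrite !inE.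
  by case: ifPn => _; rewrite ?mul1r ?mul0r.
have mBs : measurable_fun setT (fun u => \1_B (signal u) : R).
  exact: measurableT_comp (measurable_indic mB) measurable_signal.
have mss : measurable_fun setT (fun u => selected (signal u)).
  exact: measurableT_comp measurable_selected measurable_signal.
have mu22 : measurable_fun setT (fun u : R * (R * R) => u.2.2).
  exact: measurableT_comp measurable_snd measurable_snd.
have ind0 z : 0 <= \1_B z :> R by rewrite indicE.
have imK i z : 0 <= im t z i + K.
  by have := info_mean_bounded i z; rewrite ler_norml -lerBlDr sub0r => /andP[].
have yK0 j : 0 <= y j + K.
  by have := yK j; rewrite ler_norml -lerBlDr sub0r => /andP[].
rewrite (patch _ (fun u => selected (signal u) + K)); last first.
  by move=> w; rewrite info_mean_versionE.
rewrite (patch _ (fun u => u.2.2 + K))//.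
rewrite (@integral_sample (fun u => \1_B (signal u) * (selected (signal u) + K))); last 2 first.
- by apply: measurable_funM => //; exact: measurable_funD.
- by move=> a i j; rewrite /signal/= selected_grid mulr_ge0.
rewrite (@integral_sample (fun u => \1_B (signal u) * (u.2.2 + K))); last 2 first.
- by apply: measurable_funM => //; exact: measurable_funD.
- by move=> a i j; rewrite /= mulr_ge0 ?yK0.
apply: eq_bigr => i _.
have mBi : measurable_fun setT (fun z : R => \1_B (x i, z) : R).
  exact: measurableT_comp (measurable_indic mB) (measurable_pair1 (x i)).
transitivity (\sum_j (p i j)%:E * \int[mu]_a
   (\1_B (x i, (shift i j + a)) * (im t (shift i j + a) i + K) * dens t a)%:E)%E.
  apply: eq_bigr => j _; congr (_ * _)%E; apply: eq_integral => a _.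
  by rewrite /signal/= selected_grid.
rewrite (@sum_integral_translation i (fun j z => \1_B (x i, z) * (im t z i + K))); last 2 first.
- move=> j; apply: measurable_funM => //; apply: measurable_funD => //.
  exact: measurable_info_mean.
- by move=> j z; rewrite mulr_ge0.
transitivity (\sum_j (p i j)%:E * \int[mu]_a
   (\1_B (x i, (shift i j + a)) * (y j + K) * dens t a)%:E)%E; last by [].
rewrite (@sum_integral_translation i (fun j z => \1_B (x i, z) * (y j + K))); last 2 first.
- by move=> j; apply: measurable_funM.
- by move=> j z; rewrite mulr_ge0.
apply: eq_integral => z _; congr EFin.
have S0 := row_mass_gt0 rho_gt0 i z pw.
have SM : \sum_j rho i j z * p i j * im t z i = \sum_j y j * rho i j z * p i j.
  by rewrite -mulr_suml imE /posterior_mean mulrC divfK// gt_eqF.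
transitivity (\1_B (x i, z) * (\sum_j rho i j z * p i j * im t z i +
    \sum_j rho i j z * p i j * K)).
  by rewrite -big_split/= mulr_sumr; apply: eq_bigr => j _; ring.
by rewrite SM -big_split/= mulr_sumr; apply: eq_bigr => j _; ring.
Qed.

Lemma info_mean_version_risk :
  (\int[Q]_w ((X1 w - info_mean_version w) ^+ 2)%:E =
   entry_risk T0 T1 H1 H2 D g0 x y p t)%E.
Proof.
have mu22 : measurable_fun setT (fun u : R * (R * R) => u.2.2).
  exact: measurableT_comp measurable_snd measurable_snd.
transitivity (\int[Q]_w (((A t w.1, w.2).2.2 - selected (signal (A t w.1, w.2))) ^+ 2)%:E)%E.
  by apply: eq_integral => w _; rewrite info_mean_versionE.
rewrite (@integral_sample (fun u => (u.2.2 - selected (signal u)) ^+ 2)); last 2 first.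
- apply: measurable_funX; apply: measurable_funB => //.
  exact: measurableT_comp measurable_selected measurable_signal.
- by move=> a i j; exact: sqr_ge0.
apply: eq_bigr => i _; apply: eq_bigr => j _; congr (_ * _)%E.
by apply: eq_integral => a _; rewrite /signal/= selected_grid.
Qed.

(** Any version agrees almost surely with the Bayes version, so the risk at time [t] can be computed
    from the latter. *)
Lemma info_mean_risk (M : R -> Omega * (R * R) -> R) :
  is_info_mean T0 T1 H1 H2 D g0 pi M ->
  (\int[Q]_w ((X1 w - M t w) ^+ 2)%:E = entry_risk T0 T1 H1 H2 D g0 x y p t)%E.
Proof.
move=> [mM /(_ _ tI) hM]; rewrite -info_mean_version_risk.
have iX : Q.-integrable setT (EFin \o (@X1 R d Omega)) by case: hM.
have MM := cond_exp_unique measurable_X0_rap hM (info_mean_version_cond_exp iX).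
have mX1 : measurable_fun setT (@X1 R d Omega).
  exact: measurableT_comp measurable_snd measurable_snd.
have mMt : measurable_fun setT (M t).
  by have [_ /(measurable_int _)/measurable_EFinP] := hM.
have mV : measurable_fun setT info_mean_version.
  by have [_ /(measurable_int _)/measurable_EFinP] := info_mean_version_cond_exp iX.
apply: ge0_ae_eq_integral => //.
- by apply/measurable_EFinP; apply: measurable_funX; exact: measurable_funB.
- by apply/measurable_EFinP; apply: measurable_funX; exact: measurable_funB.
- by move=> w _; rewrite lee_fin sqr_ge0.
- by move=> w _; rewrite lee_fin sqr_ge0.
- by apply: filterS MM => w /= /(_ Logic.I) [->].
Qed.

End information_mean.

(** * Projected gradient ascent *)

Section projected_gradient.
Context {R : realType} {l m : nat}.
Implicit Types (p q z g : 'M[R]_(l, m)) (S : set 'M[R]_(l, m)).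

Definition mdot p q : R := \sum_i \sum_j p i j * q i j.

Lemma enorm_ge0 p : 0 <= enorm p. Proof. exact: sqrtr_ge0. Qed.

Lemma ler_enorm p q : (enorm p <= enorm q) = (enorm p ^+ 2 <= enorm q ^+ 2).
Proof. by rewrite ler_sqr ?nnegrE ?enorm_ge0. Qed.

Lemma enorm_sqr p : enorm p ^+ 2 = mdot p p.
Proof.
rewrite sqr_sqrtr; last by do 2! apply: sumr_ge0 => ? _; exact: sqr_ge0.
by do 2! apply: eq_bigr => ? _; rewrite expr2.
Qed.

Lemma enorm_sqrD p q (t : R) :
  enorm (p + t *: q) ^+ 2 = enorm p ^+ 2 + 2 * t * mdot p q + t ^+ 2 * enorm q ^+ 2.
Proof.
rewrite !enorm_sqr /mdot !mulr_sumr -!big_split/=; apply: eq_bigr => i _.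
rewrite !mulr_sumr -!big_split/=; apply: eq_bigr => j _; rewrite !mxE; ring.
Qed.

Lemma mdotBr p q z : mdot p (q - z) = mdot p q - mdot p z.
Proof.
rewrite /mdot -sumrB; apply: eq_bigr => i _; rewrite -sumrB.
by apply: eq_bigr => j _; rewrite !mxE mulrBr.
Qed.

Definition mconvex S := forall p q (t : R), S p -> S q -> 0 <= t <= 1 ->
  S (p + t *: (q - p)).

(** If the inner product were positive, a small move from [p] towards [z], which stays in the convex
    set, would come closer to [q]. *)
Lemma is_proj_variational S q p z : mconvex S -> is_proj S q p -> S z ->
  mdot (q - p) (z - p) <= 0.
Proof.
move=> cS [Sp minp] Sz; rewrite leNgt; apply/negP => d0.
set a := mdot _ _ in d0; set b := enorm (z - p) ^+ 2.
have b0 : 0 <= b by rewrite exprn_ge0// enorm_ge0.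
have key t : 0 <= t <= 1 -> 2 * t * a <= t ^+ 2 * b.
  move=> t01; have := minp _ (cS _ _ t Sp Sz t01).
  have -> : q - (p + t *: (z - p)) = (q - p) + (- t) *: (z - p).
    by rewrite scaleNr opprD addrA.
  by rewrite ler_enorm enorm_sqrD -/a -/b sqrrN; lra.
have ab0 : 0 < a + b by rewrite ltr_wpDr.
(* Then 0 < t <= 1 and [t * b <= a], so [key] would give [2 * t * a <= t * a]. The denominator
   [a + b] stays positive even if [b] vanishes. *)
set t := a / (a + b); have t0 : 0 < t by rewrite divr_gt0.
have tab : t * (a + b) = a by rewrite divfK// gt_eqF.
have ta0 : 0 < t * a by rewrite mulr_gt0.
have tb : t * b <= a by move: tab; rewrite mulrDr => <-; rewrite lerDr ltW.
have t1 : 0 <= t <= 1 by rewrite ltW//= ler_pdivrMr// mul1r lerDl.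
have := key _ t1; rewrite expr2 -[t * t * b]mulrA.
have := ler_wpM2l (ltW t0) tb; lra.
Qed.

Lemma is_proj_le S q p z : mconvex S -> is_proj S q p -> S z ->
  enorm (p - z) ^+ 2 <= enorm (q - z) ^+ 2.
Proof.
move=> cS pq Sz; have := is_proj_variational cS pq Sz.
have -> : q - z = (q - p) + (-1) *: (z - p).
  by rewrite scaleN1r opprB addrA subrK.
rewrite enorm_sqrD; have -> : p - z = 0 + (-1) *: (z - p).
  by rewrite scaleN1r opprB add0r.
rewrite enorm_sqrD; have := sqr_ge0 (enorm (q - p)).
have -> : mdot 0 (z - p) = 0.
  by rewrite /mdot; do 2! apply: big1 => ? _; rewrite mxE mul0r.
have -> : enorm (0 : 'M[R]_(l, m)) ^+ 2 = 0.
  by rewrite enorm_sqr /mdot; do 2! apply: big1 => ? _; rewrite mxE mul0r.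
lra.
Qed.

(** A regret bound for an arbitrary bounded vector field: each step lowers the squared distance to
    [z] by the linear gain, up to an error [lambda ^+ 2 * N ^+ 2]. Concavity enters only when the
    linear terms are compared with values of the objective. *)
Lemma projected_ascent_regret S (grad : 'M[R]_(l, m) -> 'M[R]_(l, m))
    (delta N eps : R) (Theta : nat) (p : nat -> 'M[R]_(l, m)) z :
  let lambda := eps / (2 * N ^+ 2) in
  mconvex S -> (forall p q, S p -> S q -> enorm (p - q) <= delta) ->
  (forall q, S q -> enorm (grad q) <= N) -> 0 < N -> 0 < eps ->
  4 * (delta ^+ 2 * N ^+ 2 / eps ^+ 2) <= Theta%:R ->
  S (p 0%N) -> S z ->
  (forall k, (1 <= k <= Theta)%N ->
    is_proj S (p k.-1 + lambda *: grad (p k.-1)) (p k)) ->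
  (forall k, (k <= Theta)%N -> S (p k)) /\
  \sum_(0 <= k < Theta) mdot (grad (p k)) (z - p k) <= Theta%:R * eps.
Proof.
move=> lambda cS hdelta hN N0 eps0 hTheta Sp0 Sz hp.
have Sp k : (k <= Theta)%N -> S (p k).
  by case: k => [//|k] kT; have [] := hp k.+1 kT.
split=> //.
have lam0 : 0 < lambda by rewrite divr_gt0// mulr_gt0// exprn_gt0.
pose a k := enorm (p k - z) ^+ 2.
have step k : (k < Theta)%N ->
    2 * lambda * mdot (grad (p k)) (z - p k) <= a k - a k.+1 + lambda ^+ 2 * N ^+ 2.
  move=> kT; have := is_proj_le cS (hp k.+1 kT) Sz.
  rewrite /= addrAC enorm_sqrD -/(a k) -/(a k.+1).
  have gN : enorm (grad (p k)) ^+ 2 <= N ^+ 2.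
    by rewrite ler_sqr ?nnegrE ?enorm_ge0 ?(ltW N0)//; apply/hN/Sp/ltnW.
  have -> : mdot (p k - z) (grad (p k)) = - mdot (grad (p k)) (z - p k).
    rewrite /mdot -sumrN; apply: eq_bigr => i _; rewrite -sumrN.
    by apply: eq_bigr => j _; rewrite !mxE; ring.
  have := ler_wpM2l (sqr_ge0 lambda) gN; lra.
have tot n : (n <= Theta)%N ->
    2 * lambda * \sum_(0 <= k < n) mdot (grad (p k)) (z - p k) <=
    a 0%N - a n + n%:R * (lambda ^+ 2 * N ^+ 2).
  elim: n => [|n IH] nT; first by rewrite big_geq// mulr0 subrr mul0r addr0.
  rewrite big_nat_recr//= mulrDr.
  by have := IH (ltnW nT); have := step n nT; rewrite -[in n.+1%:R]natr1 mulrDl mul1r; lra.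
have aT : 0 <= a Theta by exact: sqr_ge0.
have a0 : a 0%N <= delta ^+ 2.
  rewrite ler_sqr ?nnegrE ?enorm_ge0//; first exact: hdelta.
  by apply: le_trans (hdelta _ _ Sp0 Sz); exact: enorm_ge0.
have T := tot _ (leqnn Theta).
have lamN : lambda * N ^+ 2 = eps / 2.
  by rewrite /lambda; field; rewrite gt_eqF.
have lam2 : lambda ^+ 2 * N ^+ 2 = lambda * (eps / 2) by rewrite -lamN; ring.
have dT : delta ^+ 2 <= Theta%:R * (lambda * (eps / 2)).
  have -> : lambda * (eps / 2) = eps ^+ 2 / (4 * N ^+ 2).
    by rewrite /lambda; field; rewrite gt_eqF.
  rewrite mulrA ler_pdivlMr ?mulr_gt0 ?exprn_gt0//.
  move: hTheta; rewrite !mulrA ler_pdivrMr ?exprn_gt0//; lra.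
rewrite -(ler_pM2l (mulr_gt0 (ltr0n R 2) lam0)).
apply: (le_trans T); rewrite lam2.
(* The step size makes the accumulated error exactly [X], and [Theta] is large enough that the
   initial squared distance is at most [X]. The total 2 X is within the target, which is 4 X. *)
set X := Theta%:R * (lambda * (eps / 2)) in dT *.
have X0 : 0 <= X by rewrite /X mulr_ge0 ?ler0n// mulr_ge0 ?(ltW lam0)// divr_ge0// ltW.
have -> : 2 * lambda * (Theta%:R * eps) = 4 * X by rewrite /X; field.
by move: a0 aT dT X0; lra.
Qed.

End projected_gradient.

(** * Convergence of the averaged iterates *)

Section objective_of_coupling.
Context {R : realType} {d : measure_display} {Omega : measurableType d}.
Variables (P : probability Omega R) (T0 T1 : R) (H1 H2 : R -> R).
Variables (D : R -> {RV P >-> R}) (g0 : R -> R).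
Hypotheses (hT01 : T0 < T1) (hrap : standard_rap T0 T1 H1 H2 D g0).
Context {l m : nat}.
Variables (x : 'I_l -> R) (y : 'I_m -> R).
Hypotheses (hx : injective x) (hy : injective y).
Variable pi : probability (R * R)%type R.
Hypothesis pi_grid : pi (~` grid x y) = 0%E.
Hypothesis pw : proper_weights (entries x y pi).
Local Notation mu := (@lebesgue_measure R).
Local Notation I := (`]T0, T1[%classic : set R).
Local Notation Q := (P \x pi)%E.

(** Tonelli brings the time integral outside, where the risk at each fixed time does not depend on
    the version of the conditional expectation. *)
Lemma objective_entriesE (M : R -> Omega * (R * R) -> R) :
  is_info_mean T0 T1 H1 H2 D g0 pi M ->
  objective P T0 T1 H1 H2 pi M = objective_entries T0 T1 H1 H2 D g0 x y (entries x y pi).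
Proof.
move=> hM; have [mM _] := hM.
have [W [mW W0 W_off W_weight]] := measurable_weight_version hT01 hrap.
rewrite (objective_entries_version hT01 hrap x y mW W0 W_weight pw) /objective.
(* [M] is jointly measurable only on the open time strip; extension by zero makes it measurable on
   the whole product. *)
pose Mp : R * (Omega * (R * R)) -> R := (fun tw => M tw.1 tw.2) \_ (I `*` setT).
have mIT : measurable (I `*` [set: Omega * (R * R)]) by exact: measurableX.
have mMp : measurable_fun setT Mp.
  exact/(measurable_restrictT (fun tw : R * (Omega * (R * R)) => M tw.1 tw.2) mIT).
have mX1 : measurable_fun setT (@X1 R d Omega).
  exact: measurableT_comp measurable_snd measurable_snd.
have MpE t w : t \in `]T0, T1[ -> Mp (t, w) = M t w.
  by move=> tI; rewrite /Mp patchE mem_set.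
pose F (wt : (Omega * (R * R)) * measurableTypeR R) : \bar R :=
  ((X1 wt.1 - Mp (wt.2, wt.1)) ^+ 2 * W wt.2)%:E.
have F0 wt : (0 <= F wt)%E by rewrite lee_fin mulr_ge0// sqr_ge0.
have mswap : measurable_fun setT
    (fun wt : (Omega * (R * R)) * measurableTypeR R => (wt.2, wt.1)).
  by apply/measurable_fun_pairP; split; [exact: measurable_snd|exact: measurable_fst].
have mF : measurable_fun setT F.
  apply/measurable_EFinP; apply: measurable_funM; last first.
    exact: measurableT_comp mW measurable_snd.
  apply: measurable_funX; apply: measurable_funB.
    exact: measurableT_comp mX1 measurable_fst.
  exact: measurableT_comp mMp mswap.
have FE w : (\int[mu]_(t in I) ((X1 w - M t w) ^+ 2 * weight T1 H1 H2 t)%:E =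
    \int[mu]_t F (w, t))%E.
  transitivity (\int[mu]_(t in I) F (w, t))%E.
    apply: ge0_ae_eq_integral_nomeas => //.
    - by apply: measurable_funTS; exact: measurableT_comp mF (measurable_pair1 w).
    - move=> t /= tI; rewrite lee_fin mulr_ge0 ?sqr_ge0//.
      exact: (weight_ge0 hT01 hrap tI).
    - have FF : Filter (almost_everywhere mu) by exact: ae_filter_ringOfSetsType.
      by apply: filterS W_weight => t /= H tI; rewrite /F/= MpE// H.
  rewrite integral_mkcond; apply: eq_integral => t _.
  rewrite patchE mem_setE; case: ifPn => // tI.
  by rewrite /F/= W_off// mulr0.
under eq_integral do rewrite FE.
pose QQ : probability (Omega * (R * R))%type R := Q.
transitivity (\int[mu]_t \int[Q]_w F (w, t))%E.
  exact: (fubini_tonelli (m1 := QQ) (m2 := mu) F mF F0).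
rewrite [RHS]integral_mkcond; apply: eq_integral => t _.
rewrite patchE mem_setE; case: ifPn => tI; last first.
  rewrite integral0_eq// => w _.
  by rewrite /F/= W_off// mulr0.
rewrite -(info_mean_risk hT01 hrap hx hy pi_grid pw tI hM).
have mMt : measurable_fun setT (M t).
  rewrite (_ : M t = fun w => Mp (t, w)); last by apply/funext => w; rewrite MpE.
  exact: measurableT_comp mMp (measurable_pair1 t).
rewrite -ge0_integralZl.
- by apply: eq_integral => w _; rewrite /F/= MpE// mulrC EFinM.
- exact: measurableT.
- by apply/measurable_EFinP; apply: measurable_funX; exact: measurable_funB.
- by move=> w _; rewrite lee_fin sqr_ge0.
- by rewrite lee_fin.
Qed.

End objective_of_coupling.

Section polytope_facts.
Context {R : realType} {l m : nat}.
Variables (x : 'I_l -> R) (y : 'I_m -> R).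
Hypothesis (l0 : (0 < l)%N).
Implicit Types p q : 'M[R]_(l, m).

Lemma polytope_proper p : coupling_polytope x y p -> proper_weights p.
Proof. by move=> [p0 prow _ _]; split=> // i; rewrite prow invr_gt0 ltr0n. Qed.

Lemma polytope_convex : mconvex (coupling_polytope x y).
Proof.
move=> p q t [p0 pr pc pm] [q0 qr qc qm] /andP[t0 t1].
have E i j : (p + t *: (q - p)) i j = (1 - t) * p i j + t * q i j.
  by rewrite !mxE; ring.
split=> [i j|i|j|i].
- by rewrite E addr_ge0// mulr_ge0// subr_ge0.
- under eq_bigr do rewrite E.
  by rewrite big_split/= -!mulr_sumr pr qr; ring.
- under eq_bigr do rewrite E.
  by rewrite big_split/= -!mulr_sumr pc qc; ring.
- under eq_bigr do rewrite E mulrDl -!mulrA.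
  by rewrite big_split/= -!mulr_sumr pm qm; ring.
Qed.

Lemma polytope_average (n : nat) (p : nat -> 'M[R]_(l, m)) : (0 < n)%N ->
  (forall k, (k < n)%N -> coupling_polytope x y (p k)) ->
  coupling_polytope x y (n%:R^-1 *: \sum_(k < n) p k).
Proof.
move=> n0 hp; have nR : n%:R != 0 :> R by rewrite pnatr_eq0 -lt0n.
have E i j : (n%:R^-1 *: \sum_(k < n) p k) i j = n%:R^-1 * \sum_(k < n) p k i j.
  by rewrite mxE summxE.
have avg (c : R) : n%:R^-1 * \sum_(k < n) c = c.
  by rewrite sumr_const card_ord -[c *+ n]mulr_natl mulKf.
split=> [i j|i|j|i].
- rewrite E mulr_ge0 ?invr_ge0 ?ler0n//; apply: sumr_ge0 => k _.
  by have [H _ _ _] := hp k (ltn_ord k).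
- under eq_bigr do rewrite E.
  rewrite -mulr_sumr exchange_big/= -[RHS]avg; congr (_ * _).
  by apply: eq_bigr => k _; have [_ H _ _] := hp k (ltn_ord k).
- under eq_bigr do rewrite E.
  rewrite -mulr_sumr exchange_big/= -[RHS]avg; congr (_ * _).
  by apply: eq_bigr => k _; have [_ _ H _] := hp k (ltn_ord k).
- under eq_bigr do rewrite E -mulrA mulr_suml.
  rewrite -mulr_sumr exchange_big/= -[RHS]avg; congr (_ * _).
  by apply: eq_bigr => k _; have [_ _ _ H] := hp k (ltn_ord k).
Qed.

End polytope_facts.

Theorem proposition4p2 (R : realType)
    (d : measure_display) (Omega : measurableType d) (P : probability Omega R)
    (T0 T1 : R) (hT0 : 0 <= T0) (hT01 : T0 < T1)
    (H1 H2 : R -> R) (D : R -> {RV P >-> R}) (g0 : R -> R)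
    (hrap : standard_rap T0 T1 H1 H2 D g0)
    (l m : nat) (hl : (2 <= l)%N) (hm : (2 <= m)%N)
    (x : 'I_l -> R) (y : 'I_m -> R) (hx : injective x) (hy : injective y)
    (hcx : convex_order (empirical x) (empirical y))
    (hreg : forall pi, martingale_coupling (empirical x) (empirical y) pi ->
      rap_regular T0 T1 H1 H2 D g0 x y pi)
    (M : probability (R * R)%type R -> R -> Omega * (R * R) -> R)
    (hM : forall pi, martingale_coupling (empirical x) (empirical y) pi ->
      is_info_mean T0 T1 H1 H2 D g0 pi (M pi))
    (gradK : 'M[R]_(l, m) -> 'M[R]_(l, m))
    (hgradK : forall p, coupling_entries x y p ->
      is_gradient (objective_entries T0 T1 H1 H2 D g0 x y) p (gradK p))
    (pistar : probability (R * R)%type R)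
    (hpistar : martingale_coupling (empirical x) (empirical y) pistar)
    (hmax : forall pi, martingale_coupling (empirical x) (empirical y) pi ->
      (objective P T0 T1 H1 H2 pi (M pi) <=
       objective P T0 T1 H1 H2 pistar (M pistar))%E)
    (eps : R) (heps : 0 < eps)
    (delta : R) (hdelta : is_max_dist (coupling_entries x y) delta) :
  let gradK_norms := [set enorm (gradK p) | p in coupling_entries x y] in
  let normgradK := sup gradK_norms in
  let Theta :=
    (4 * `|Num.ceil (delta ^+ 2 * normgradK ^+ 2 / eps ^+ 2)|)%N in
  let lambda := eps / (2 * normgradK ^+ 2) in
  has_ubound gradK_norms -> 0 < normgradK -> (1 <= Theta)%N ->
  forall p : nat -> 'M[R]_(l, m),
  coupling_entries x y (p 0%N) ->
  (forall theta, (1 <= theta <= Theta)%N ->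
    is_proj (coupling_entries x y)
      (p theta.-1 + lambda *: gradK (p theta.-1)) (p theta)) ->
  exists piavg : probability (R * R)%type R,
  [/\ martingale_coupling (empirical x) (empirical y) piavg,
      entries x y piavg =
        Theta%:R^-1 *: \sum_(1 <= theta < Theta.+1) p theta.-1 &
      (objective P T0 T1 H1 H2 pistar (M pistar) -
       objective P T0 T1 H1 H2 piavg (M piavg) <= eps%:E)%E].
Proof.
move=> gradK_norms N Theta lambda hub N0 Theta1 p Sp0 hp.
have l0 : (0 < l)%N by exact: leq_trans hl.
have m0 : (0 < m)%N by exact: leq_trans hm.
set S := coupling_polytope x y.
have SE : coupling_entries x y = [set q | S q] by exact: coupling_entriesE.
have [W [mW W0 W_off W_weight]] := measurable_weight_version hT01 hrap.
pose F := objective_entries T0 T1 H1 H2 D g0 x y.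
have FE := objective_entries_mixture hT01 hrap x y mW W0 W_off W_weight.
have pwS q : S q -> proper_weights q by exact: polytope_proper.
have mWf : measurable_fun setT (fun u : measurableTypeR R * measurableTypeR R => W u.1).
  exact: measurableT_comp mW measurable_fst.
have W0f (u : measurableTypeR R * measurableTypeR R) : 0 <= W u.1 by [].
have mrho := measurable_centred_density hT01 hrap x y.
have rho0 := centred_density_gt0 hT01 hrap x y.
(* The equality is Euler's identity for a functional homogeneous of degree one. The inequality is
   the tangent majorant, now expressed by the given gradient. *)
have key q : S q -> F q = (mdot (gradK q) q)%:E /\
    forall q', S q' -> (F q' <= (mdot (gradK q) q')%:E)%E.
  move=> Sq; have gq : is_gradient F q (gradK q) by apply: hgradK; rewrite SE.
  have [_ gE] := mixture_functional_gradient mWf W0f mrho rho0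
    FE l0 m0 (pwS _ Sq) gq.
  have dotE (q' : 'M[R]_(l, m)) : (\sum_i \sum_j (q' i j)%:E * mean_sqdev (lebesgue_measure \x lebesgue_measure)%E y
      (fun u => W u.1) (centred_density T0 T1 H1 H2 g0 x y) q i j = (mdot (gradK q) q')%:E)%E.
    rewrite /mdot -sumEFin; apply: eq_bigr => i _; rewrite -sumEFin.
    by apply: eq_bigr => j _; rewrite -gE -EFinM mulrC.
  split=> [|q' Sq'].
    rewrite /F (FE _ (pwS _ Sq)) -dotE.
    exact: (mixture_functional_self _ y mWf W0f mrho rho0 (pwS _ Sq)).
  rewrite /F (FE _ (pwS _ Sq')) -dotE.
  exact: (mixture_functional_le _ y mWf W0f mrho rho0 (pwS _ Sq) (pwS _ Sq')).
have Spi pi : martingale_coupling (empirical x) (empirical y) pi -> S (entries x y pi).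
  exact: coupling_in_polytope.
have objE pi : martingale_coupling (empirical x) (empirical y) pi ->
    objective P T0 T1 H1 H2 pi (M pi) = F (entries x y pi).
  move=> hpi; apply: objective_entriesE => //.
  - exact: (coupling_grid hpi).
  - exact/pwS/Spi.
  - exact: hM.
have [[pd [qd [_ _ _]]] hdist] := hdelta.
have hN q : S q -> enorm (gradK q) <= N.
  move=> Sq; apply: ub_le_sup => //.
  by exists q => //; rewrite SE.
have hTheta : 4 * (delta ^+ 2 * N ^+ 2 / eps ^+ 2) <= Theta%:R.
  (* Passing from the integer ceiling to its absolute value can only increase it. *)
  rewrite /Theta natrM ler_pM2l// natr_absz; set r := (_ / _).
  by apply: (le_trans (ceil_ge r)); rewrite ler_int ler_norm.
set pstar := entries x y pistar.
have Sstar : S pstar by exact: Spi.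
rewrite SE in Sp0 hdist hp.
have [Sp regret] := projected_ascent_regret (polytope_convex (x := x) (y := y))
  hdist hN N0 heps hTheta Sp0 Sstar hp.
pose pbar := Theta%:R^-1 *: \sum_(k < Theta) p k.
have Sbar : S pbar.
  by apply: polytope_average => // k kT; exact/Sp/ltnW.
have [piavg [hpiavg piavgE]] := polytope_coupling l0 hx hy Sbar.
exists piavg; split => //.
  (* The predecessor shifts the indices to 0, ..., [Theta] - 1, so the last projection does not
     enter the average. *)
  by rewrite piavgE /pbar big_add1 big_mkord.
rewrite !objE// piavgE -/pstar (key _ Sstar).1 (key _ Sbar).1 -EFinB lee_fin.
have ThR : 0 < Theta%:R :> R by rewrite ltr0n.
have real_key q q' : S q -> S q' -> mdot (gradK q') q' <= mdot (gradK q) q'.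
  by move=> Sq Sq'; rewrite -lee_fin -(key _ Sq').1; exact: (key _ Sq).2.
(* The tangent majorant at each iterate is evaluated at the maximiser and summed, then the regret
   bound is inserted. *)
have lo : Theta%:R * mdot (gradK pstar) pstar <=
    \sum_(k < Theta) mdot (gradK (p k)) (p k) + Theta%:R * eps.
  rewrite -lerBlDl; apply: le_trans regret.
  rewrite big_mkord lerBlDl -big_split/= mulr_natl -[X in _ *+ X]card_ord -sumr_const.
  apply: ler_sum => k _; rewrite mdotBr addrC subrK.
  by apply: real_key => //; exact/Sp/ltnW.
(* Jensen's inequality through the tangent at the average: the linear majorant at [pbar], summed
   over the iterates, returns [Theta] times the value at [pbar]. *)
have hi : \sum_(k < Theta) mdot (gradK (p k)) (p k) <= Theta%:R * mdot (gradK pbar) pbar.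
  have -> : Theta%:R * mdot (gradK pbar) pbar = \sum_(k < Theta) mdot (gradK pbar) (p k).
    rewrite [RHS]exchange_big/= /mdot mulr_sumr; apply: eq_bigr => i _.
    rewrite [RHS]exchange_big/= mulr_sumr; apply: eq_bigr => j _.
    rewrite -mulr_sumr mulrCA; congr (_ * _).
    by rewrite mxE summxE mulVKf// gt_eqF.
  by apply: ler_sum => k _; apply: real_key => //; exact/Sp/ltnW.
rewrite lerBlDr addrC -(ler_pM2l ThR) mulrDr.
by apply: (le_trans lo); rewrite lerD2r.
Qed.
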